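(* Let $(A,\mathcal{D})$ be a digit system with $b\geqslant 2$, and let $\mathcal{F}=\mathcal{F}(A,\mathcal{D})\subset\mathbb{K}_A$. The following assertions are equivalent: (i) $\mathcal{F}$ has positive measure, i.e. $\mu(\mathcal{F})>0$; (ii) $\mathcal{F}$ has nonempty interior; (iii) $\mathcal{F}$ is the closure of its interior, and its boundary $\partial\mathcal{F}$ has $\mu$-measure zero.
   Context: Let $n\geqslant 1$ and let $A\in\mathbb{Q}^{n\times n}$ be expanding (all eigenvalues have absolute value $>1$); put $B:=A^{-1}$. For an invertible $M\in\mathbb{Q}^{n\times n}$ let $\mathbb{Z}^n[M]:=\bigcup_{k\geqslant 1}(\mathbb{Z}^n+M\mathbb{Z}^n+\dots+M^{k-1}\mathbb{Z}^n)$. Put $a:=|\mathbb{Z}^n[A]/A\mathbb{Z}^n[A]|$ and $b:=|\mathbb{Z}^n[B]/B\mathbb{Z}^n[B]|$ (both finite). Representation space: let $\mathbb{Z}^n(B):=\bigcup_{k\geqslant 1}(B^{-k}\mathbb{Z}^n+B^{-k+1}\mathbb{Z}^n+\dots+B^k\mathbb{Z}^n)$. For $y\in\mathbb{Z}^n(B)$ let $\nu(y):=\inf\{k\in\mathbb{Z} : y\notin B^{k+1}\mathbb{Z}^n[B]\}\in\mathbb{Z}\cup\{\infty\}$ (with $\inf\varnothing=\infty$), and ${\bf d}_B(y,y'):=b^{-\nu(y-y')}$, with $b^{-\infty}=0$. $\mathbb{Z}^n((B))$ is the completion of $\mathbb{Z}^n(B)$ with respect to ${\bf d}_B$ (points at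 distance $0$ being identified); the group structure, $\nu$, ${\bf d}_B$ and multiplication by $A$ and $B$ extend to it, and elements of $\mathbb{Z}^n(B)$ are regarded as elements of $\mathbb{Z}^n((B))$ via the canonical map. $\mathbb{Z}^n[[B]]:=\{y\in\mathbb{Z}^n((B)):\nu(y)\geqslant 0\}$, and $\mu_B$ is the Haar measure on $\mathbb{Z}^n((B))$ with $\mu_B(\mathbb{Z}^n[[B]])=1$. Let $\mathbb{K}_A:=\mathbb{R}^n\times\mathbb{Z}^n((B))$, with metric ${\bf d}((x,y),(x',y')):=\max\{\|x-x'\|,{\bf d}_B(y,y')\}$ ($\|\cdot\|$ Euclidean) and Haar measure $\mu:=\lambda\times\mu_B$, $\lambda$ being Lebesgue measure. $A$ acts by $A(x,y)=(Ax,Ay)$. Let $\varphi:\mathbb{Z}^n(B)\to\mathbb{K}_A$, $\varphi(x)=(x,x)$. A digit system is a pair $(A,\mathcal{D})$ with $A\in\mathbb{Q}^{n\times n}$ expanding and $\mathcal{D}\subset\mathbb{Z}^n[A]$, $|\mathcal{D}|=a$. $\mathcal{F}(A,\mathcal{D})\subset\mathbb{K}_A$ is the unique nonempty compact set with $A\mathcal{F}=\bigcup_{d\in\mathcal{D}}(\mathcal{F}+\varphi(d))$; explicitly $\mathcal{F}=\{\sum_{j\geqslant1}A^{-j}\varphi(d_j): d_j\in\mathcal{D}\}$. *)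

(* Defs.v *)
From HB Require Import structures.
From mathcomp Require Import all_boot all_order all_algebra.
From mathcomp Require Import generic_quotient ring_quotient.
From mathcomp Require Import complex finmap zify.
From mathcomp Require Import all_classical all_reals all_analysis.

Set Implicit Arguments.
Unset Strict Implicit.
Unset Printing Implicit Defensive.

Import Order.TTheory GRing.Theory Num.Theory.
Import numFieldNormedType.Exports numFieldTopology.Exports.

Local Open Scope classical_set_scope.
Local Open Scope ring_scope.

Definition expanding (R : realType) (n : nat) (A : 'M[rat]_n.+1) : Prop :=
  forall z : R[i], eigenvalue (map_mx ratr A : 'M[R[i]]_n.+1) z -> 1 < `|z|.

Lemma expanding_unit (R : realType) (n : nat) (A : 'M[rat]_n.+1) :
  expanding R A -> A \is a GRing.unit.
Proof.
move=> hA; case: (boolP (A \is a GRing.unit)) => // nA; exfalso.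
suff /hA : eigenvalue (map_mx ratr A : 'M[R[i]]_n.+1) 0.
  by rewrite normr0 ltr10.
rewrite /eigenvalue /eigenspace raddf0 subr0 kermx_eq0 row_free_unit.
by rewrite map_unitmx; exact: nA.
Qed.

Section lattices.
Context {n : nat}.
Implicit Types M : 'M[rat]_n.+1.

Local Notation intv := (map_mx (intr : int -> rat)).

(* Z^n[M] *)
Definition Zpoly M : set 'cV[rat]_n.+1 :=
  [set x | exists k (z : nat -> 'cV[int]_n.+1),
     x = \sum_(i < k.+1) M ^+ i *m intv (z i)].

(* Z^n(M) *)
Definition Zlaurent M : set 'cV[rat]_n.+1 :=
  [set x | exists k (z : nat -> 'cV[int]_n.+1),
     x = \sum_(i < (k.+1.*2).+1) M ^ (i%:Z - k.+1%:Z) *m intv (z i)].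

(* Number of cosets of M Z^n[M] in Z^n[M] (0 if there are infinitely many). *)
Definition Zindex M : nat :=
  #|` fset_set ([set [set x + M *m y | y in Zpoly M] | x in Zpoly M])|.

(* M^k Z^n[M] *)
Definition Zfilt M (k : int) : set 'cV[rat]_n.+1 :=
  [set M ^ k *m x | x in Zpoly M].

Let Zdeg M l : set 'cV[rat]_n.+1 :=
  [set x | exists z : nat -> 'cV[int]_n.+1,
     x = \sum_(i < l.+1) M ^+ i *m intv (z i)].

Let Zdeg_widen M l m x : (l <= m)%N -> Zdeg M l x -> Zdeg M m x.
Proof.
move=> lm [z ->]; exists (fun i => if (i < l.+1)%N then z i else 0).
rewrite (big_ord_widen m.+1 (fun i => M ^+ i *m intv (z i))) ?ltnS //.
rewrite big_mkcond; apply: eq_bigr => i _.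
by case: ifP => // _; rewrite raddf0 mulmx0.
Qed.

Let Zdeg_mul M l x : Zdeg M l x -> Zdeg M l.+1 (M *m x).
Proof.
move=> [z ->]; exists (fun i => if i is j.+1 then z j else 0).
rewrite [RHS]big_ord_recl /= raddf0 mulmx0 add0r mulmx_sumr.
by apply: eq_bigr => i _; rewrite mulmxA exprS.
Qed.

Let Zdeg_sub M l x y : Zdeg M l x -> Zdeg M l y -> Zdeg M l (x - y).
Proof.
move=> [z ->] [w ->]; exists (fun i => z i - w i).
by rewrite -sumrB; apply: eq_bigr => i _; rewrite raddfB mulmxBr.
Qed.

Lemma Zpoly_sub M x y : Zpoly M x -> Zpoly M y -> Zpoly M (x - y).
Proof.
move=> [k kx] [l ly]; exists (maxn k l); apply: Zdeg_sub.
  exact: (Zdeg_widen (leq_maxl k l)).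
exact: (Zdeg_widen (leq_maxr k l)).
Qed.

Lemma Zpoly_mul M x : Zpoly M x -> Zpoly M (M *m x).
Proof. by move=> [k kx]; exists k.+1; exact: Zdeg_mul. Qed.

Lemma Zfilt_sub M k x y : Zfilt M k x -> Zfilt M k y -> Zfilt M k (x - y).
Proof.
move=> [u ux <-] [v vy <-]; exists (u - v); first exact: Zpoly_sub.
by rewrite mulmxBr.
Qed.

Lemma Zfilt_mul M (k j : int) x : M \is a GRing.unit ->
  Zfilt M k x -> Zfilt M (j + k) (M ^ j *m x).
Proof.
by move=> uM [u ux <-]; exists u => //; rewrite mulmxA exprzDr.
Qed.

Lemma Zfilt_le M (j k : int) x : M \is a GRing.unit -> j <= k ->
  Zfilt M k x -> Zfilt M j x.
Proof.
move=> uM; rewrite -subr_ge0; move e : (k - j) => [m|//] _.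
have -> : k = j + m by rewrite -e addrC subrK.
elim: m {k e} => [|m IH]; first by rewrite addr0.
move=> [u ux xE]; apply: IH; exists (M *m u); first exact: Zpoly_mul.
have ME : M ^ (j + m.+1) = M ^ (j + m) * M.
  by rewrite -{3}[M]expr1z -exprzDr // -addrA -PoszD addn1.
by rewrite -xE ME mulmxA.
Qed.

Lemma ZlaurentE M x : M \is a GRing.unit ->
  Zlaurent M x <-> exists k : nat, Zfilt M (- k%:Z) x.
Proof.
move=> uM; split=> [[k [z ->]]|[k [u [l ul] <-]]].
  exists k.+1; exists (\sum_(i < (k.+1.*2).+1) M ^+ i *m intv (z i)).
    by exists (k.+1.*2), z.
  rewrite mulmx_sumr; apply: eq_bigr => i _.
  by rewrite mulmxA -[_ ^+ i]/(M ^ i%:Z) addrC exprzDr.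
have mulE i j : M ^ i *m M ^ j = M ^ (i + j) by rewrite exprzDr.
have iterM j : Zdeg M (l + j) (M ^+ j *m u).
  elim: j => [|j IH]; first by rewrite addn0 mul1mx.
  by rewrite exprS -mulmxA addnS; exact: Zdeg_mul.
pose N := (l + k)%N.
have : Zdeg M (N.+1.*2) (M ^+ (N.+1 - k) *m u).
  apply: (Zdeg_widen _ (iterM _)); rewrite /N -addnn; lia.
move=> [z zE]; exists N, z.
have kN : (k <= N.+1)%N by rewrite /N; lia.
transitivity (M ^ (- N.+1%:Z) *m (M ^+ (N.+1 - k) *m u)).
  rewrite mulmxA -[_ ^+ (_ - _)]/(M ^ (N.+1 - k)%N%:Z) mulE.
  by rewrite -subzn // addrA addNr add0r.
rewrite zE mulmx_sumr; apply: eq_bigr => i _.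
by rewrite mulmxA -[_ ^+ i]/(M ^ i%:Z) [i%:Z - _]addrC exprzDr.
Qed.

End lattices.

Section distance.
Context {R : realType} {n : nat}.
Variable M : 'M[rat]_n.+1.

(* nu y = inf {k in Z : y notin M^(k+1) Z^n[M]}, with inf of the empty set +oo *)
Definition nu (y : 'cV[rat]_n.+1) : \bar R :=
  ereal_inf [set (k%:~R)%:E | k in [set k : int | ~ Zfilt M (k + 1) y]].

(* d(y, y') = b^(- nu (y - y')); nu is never -oo on Z^n(M) for M invertible *)
Definition dnu (y y' : 'cV[rat]_n.+1) : R :=
  if nu (y - y') is r%:E then (Zindex M)%:R `^ (- r) else 0.

Lemma nu_gtNy y : M \is a GRing.unit -> Zlaurent M y -> nu y != -oo%E.
Proof.
move=> uM /ZlaurentE -/(_ uM) [k ky].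
suff : ((- (k.+1%:Z))%:~R%:E <= nu y)%E by case: (nu y).
apply: le_ereal_inf_tmp => _ [j nj <-]; rewrite lee_fin ler_int.
rewrite leNgt; apply/negP => jk; apply: nj; apply: Zfilt_le ky => //; lia.
Qed.

Lemma nu0 : nu 0 = +oo%E.
Proof.
rewrite /nu (_ : [set k | _] = set0) ?image_set0 ?ereal_inf0 //.
rewrite -subset0 => k; apply; exists 0; last by rewrite mulmx0.
by exists 0%N, (fun=> 0); rewrite big1 // => i _; rewrite raddf0 mulmx0.
Qed.

Lemma le_nuB x y : (Order.min (nu x) (nu y) <= nu (x - y))%E.
Proof.
apply: le_ereal_inf_tmp => _ [k kxy <-].
have [kx|kx] := pselect (Zfilt M (k + 1) x); last first.
  by rewrite ge_min ereal_inf_lbound //; exists k.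
have [ky|ky] := pselect (Zfilt M (k + 1) y); last first.
  by rewrite ge_min orbC ereal_inf_lbound //; exists k.
by case: kxy; exact: Zfilt_sub.
Qed.

Lemma nuN x : nu (- x) = nu x.
Proof.
have H y : (nu y <= nu (- y))%E.
  by have := le_nuB 0 y; rewrite sub0r nu0 min_r // leey.
by apply/eqP; rewrite eq_le H -{2}[x]opprK H.
Qed.

Lemma dnu_ge0 x y : 0 <= dnu x y.
Proof. by rewrite /dnu; case: (nu _) => // r; exact: powR_ge0. Qed.

Lemma dnuxx x : dnu x x = 0.
Proof. by rewrite /dnu subrr nu0. Qed.

Lemma dnuC x y : dnu x y = dnu y x.
Proof. by rewrite /dnu -opprB nuN. Qed.

Lemma dnuB0 x y : dnu (x - y) 0 = dnu x y.
Proof. by rewrite /dnu subr0. Qed.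

(* x and y range over Z^n(M) *)
Lemma dnu_ultra x y : M \is a GRing.unit -> (0 < Zindex M)%N ->
  Zlaurent M x -> Zlaurent M y ->
  dnu x y <= Num.max (dnu x 0) (dnu y 0).
Proof.
move=> uM b0 /(nu_gtNy uM) xN /(nu_gtNy uM) yN.
have le (r s : R) : r <= s ->
    (Zindex M)%:R `^ (- s) <= (Zindex M)%:R `^ (- r) :> R.
  by move=> rs; rewrite ler_powR ?ler1n // lerN2.
rewrite /dnu !subr0; have := le_nuB x y.
case: (nu (x - y)) => [t||] /=; rewrite ?le_max ?powR_ge0; last 2 first.
- by move=> _; move: (dnu_ge0 x 0); rewrite /dnu subr0 => ->.
- by move=> _; move: (dnu_ge0 x 0); rewrite /dnu subr0 => ->.
case: (nu x) xN => [r _|_|//]; case: (nu y) yN => [s _|_|//];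
  rewrite ge_min ?lee_fin ?leye_eq ?orbF //= => H.
- by apply/orP; case/orP: H => /le; [left|right].
- by rewrite le.
- by rewrite orbC le.
Qed.

Lemma le_nuV y : M \is a GRing.unit -> (nu y <= nu (M^-1 *m y) + 1)%E.
Proof.
move=> uM; rewrite -leeBlDr //; apply: le_ereal_inf_tmp => _ [k kMy <-].
rewrite leeBlDr // -EFinD -intrD1; apply: ereal_inf_lbound.
exists (k + 1) => //= ky; apply: kMy.
have := Zfilt_mul (-1) uM ky.
by rewrite exprN1 addrC addrK.
Qed.

Lemma dnuV x y : M \is a GRing.unit -> (0 < Zindex M)%N ->
  Zlaurent M (x - y) ->
  dnu (M^-1 *m x) (M^-1 *m y) <= (Zindex M)%:R * dnu x y.
Proof.
move=> uM b0 /(nu_gtNy uM); rewrite /dnu -mulmxBr; move: (le_nuV (x - y) uM).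
have bge0 : 0 <= (Zindex M)%:R :> R by [].
have : 0 <= (Zindex M)%:R * dnu x y by rewrite mulr_ge0 ?dnu_ge0.
rewrite /dnu; case: (nu (M^-1 *m _)) => [r||] // _.
case: (nu (x - y)) => [s||] //=.
rewrite -EFinD lee_fin => rs _.
rewrite -{2}(powRr1 bge0) -powRD ?pnatr_eq0 ?gtn_eqF ?implybT //.
by rewrite ler_powR ?ler1n // lerNl opprB lerBlDr.
Qed.

End distance.

Section completion.
Context {R : realType} {n : nat} {A : 'M[rat]_n.+1}.
Variables (hA : expanding R A) (hb : (1 < Zindex A^-1)%N).

Local Notation B := (A^-1).

Let uB : B \is a GRing.unit.
Proof. by rewrite unitrV; exact: expanding_unit hA. Qed.

Let b0 : (0 < Zindex B)%N. Proof. exact: ltnW hb. Qed.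

(* The unused arguments of ZBpred and cauchyB let the closure properties, which
   need A invertible and b > 0, be declared as canonical instances. *)
Definition ZBpred of expanding R A : {pred 'cV[rat]_n.+1} :=
  fun x => `[< Zlaurent B x >].

Let ZBpred_closed : zmod_closed (ZBpred hA).
Proof.
split=> [|x y].
  by apply/asboolP/(ZlaurentE _ uB); exists 0%N, 0; rewrite ?mulmx0 //;
     exists 0%N, (fun=> 0); rewrite big1 // => i _; rewrite raddf0 mulmx0.
move=> /asboolP/(ZlaurentE _ uB)[k kx] /asboolP/(ZlaurentE _ uB)[l ly].
apply/asboolP/(ZlaurentE _ uB); exists (maxn k l).
by apply: Zfilt_sub; [apply: Zfilt_le kx|apply: Zfilt_le ly] => //; lia.
Qed.

HB.instance Definition _ := GRing.isZmodClosed.Build _ (ZBpred hA) ZBpred_closed.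

(* Z^n(B) as a group *)
Record ZB := MkZB { ZBval :> 'cV[rat]_n.+1; _ : ZBval \in ZBpred hA }.

HB.instance Definition _ := [isSub for ZBval].
HB.instance Definition _ := [Choice of ZB by <:].
HB.instance Definition _ := [SubChoice_isSubZmodule of ZB by <:].

Lemma ZBvalP (x : ZB) : Zlaurent B x. Proof. by case: x => x /= /asboolP. Qed.

Let ZBmulA_subproof (x : ZB) : A *m ZBval x \in ZBpred hA.
Proof.
have /(ZlaurentE _ uB)[k kx] := ZBvalP x.
apply/asboolP/(ZlaurentE _ uB); exists k.+1.
have := Zfilt_mul (-1) uB kx.
rewrite (_ : B ^ (-1) = A); last by rewrite -exprz_inv invrK expr1z.
by rewrite -opprD -PoszD add1n.
Qed.

Definition ZBmulA (x : ZB) : ZB := MkZB (ZBmulA_subproof x).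

Definition dB (x y : ZB) : R := dnu B x y.

Let dBB0 x y : dB (x - y) 0 = dB x y.
Proof. exact: (dnuB0 B (ZBval x) (ZBval y)). Qed.

Let dBC x y : dB x y = dB y x. Proof. exact: dnuC. Qed.

Let dB_ultra x y : dB x y <= Num.max (dB x 0) (dB y 0).
Proof. by apply: dnu_ultra => //; exact: ZBvalP. Qed.

Let dB_triangle y x z : dB x z <= dB x y + dB y z.
Proof.
have -> : dB x z = dB (x - y) (z - y).
  by rewrite -dBB0 -[RHS]dBB0 opprB addrA subrK.
apply: le_trans (dB_ultra _ _) _; rewrite !dBB0 (dBC z y).
by rewrite ge_max lerDl lerDr !dnu_ge0.
Qed.

Let dB_dist x y x' y' : `|dB x y - dB x' y'| <= dB x x' + dB y y'.
Proof.
have H u v u' v' : dB u v - dB u' v' <= dB u u' + dB v v'.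
  rewrite lerBlDr (le_trans (dB_triangle u' _ _)) // -addrA lerD2l.
  by rewrite [leRHS]addrC (dBC v v'); exact: dB_triangle.
rewrite ler_norml H andbT lerNl opprB (le_trans (H _ _ _ _)) //.
by rewrite (dBC x') (dBC y').
Qed.

Definition cauchyB of (1 < Zindex B)%N : {pred nat -> ZB} :=
  fun u => `[< forall e : R, 0 < e ->
    exists N, forall p q, (N <= p)%N -> (N <= q)%N -> dB (u p) (u q) < e >].

Let cauchyB_closed : zmod_closed (cauchyB hb).
Proof.
split=> [|u v /asboolP cu /asboolP cv]; apply/asboolP => e e0.
  by exists 0%N => p q _ _; rewrite /dB dnuxx.
have [N HN] := cu _ e0; have [N' HN'] := cv _ e0.
exists (maxn N N') => p q; rewrite !geq_max => /andP[Np N'p] /andP[Nq N'q].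
have -> : dB ((u - v) p) ((u - v) q) = dB (u p - u q) (v p - v q).
  by rewrite -dBB0 -[RHS]dBB0 !opprD !opprK addrACA.
by apply: le_lt_trans (dB_ultra _ _) _; rewrite gt_max !dBB0 HN ?HN'.
Qed.

HB.instance Definition _ :=
  GRing.isZmodClosed.Build _ (cauchyB hb) cauchyB_closed.

Record cauchy_seq := MkCauchy {
  cauchy_val :> nat -> ZB; _ : cauchy_val \in cauchyB hb }.

HB.instance Definition _ := [isSub for cauchy_val].
HB.instance Definition _ := [Choice of cauchy_seq by <:].
HB.instance Definition _ := [SubChoice_isSubZmodule of cauchy_seq by <:].

Definition nullB : {pred cauchy_seq} :=
  fun u => `[< dB (u k) 0 @[k --> \oo] --> 0 >].

Let cvg_dB (u v : cauchy_seq) : cvg (dB (u k) (v k) @[k --> \oo]).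
Proof.
case: u v => [u /asboolP cu] [v /asboolP cv] /=.
apply/cauchy_cvgP/cauchy_exP => e e0; have e2 : 0 < e / 2 by rewrite divr_gt0.
have [N HN] := cu _ e2; have [N' HN'] := cv _ e2.
pose m := maxn N N'; exists (dB (u m) (v m)); exists m => // k /= mk.
rewrite /ball /=; apply: le_lt_trans (dB_dist _ _ _ _) _.
have : (N <= m)%N /\ (N' <= m)%N by rewrite leq_maxl leq_maxr.
move=> [Nm N'm]; rewrite [ltRHS]splitr ltrD ?HN ?HN' //.
  exact: leq_trans mk.
exact: leq_trans mk.
Qed.

Let nullB_closed : zmod_closed nullB.
Proof.
split=> [|u v /asboolP cu /asboolP cv]; apply/asboolP.
  by rewrite (_ : (fun k => _) = fun=> 0);
    [exact: cvg_cst|apply/funext => k; rewrite /dB dnuxx].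
apply: (@squeeze_cvgr _ _ _ _ (fun=> 0) (fun k => dB (u k) 0 + dB (v k) 0)).
- apply: nearW => k; rewrite dnu_ge0 /=.
  rewrite [dB _ 0](_ : _ = dB (u k) (v k)); last exact: dBB0.
  by rewrite (le_trans (dB_triangle 0 _ _)) // (dBC 0).
- exact: cvg_cst.
- by rewrite -[0 in X in _ --> X]addr0; exact: cvgD.
Qed.

HB.instance Definition _ := GRing.isZmodClosed.Build _ nullB nullB_closed.

(* Z^n((B)): Cauchy sequences of Z^n(B) modulo null sequences *)
Definition Zcompl := Quotient.quot nullB.

HB.instance Definition _ := GRing.Zmodule.on Zcompl.
HB.instance Definition _ := isPointed.Build Zcompl 0.

Definition Zclass (u : cauchy_seq) : Zcompl := (\pi_Zcompl u)%qT.

Definition Zdist (x y : Zcompl) : R :=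
  lim (dB (repr x k) (repr y k) @[k --> \oo]).

Let nullP (u v : cauchy_seq) :
  Zclass u = Zclass v <-> dB (u k) (v k) @[k --> \oo] --> 0.
Proof.
rewrite (_ : (fun k => dB (u k) (v k)) = fun k => dB ((u - v) k) 0).
  split=> [/eqP|uv]; last first.
    by apply/eqP; rewrite -Quotient.idealrBE; apply/asboolP.
  by rewrite -Quotient.idealrBE => /asboolP.
by apply/funext => k; rewrite -dBB0.
Qed.

Let reprK' x : Zclass (repr x) = x. Proof. exact: reprK. Qed.

Let Zdistxx x : Zdist x x = 0.
Proof.
rewrite /Zdist (_ : (fun k => _) = fun=> 0) ?lim_cst //.
by apply/funext => k; exact: dnuxx.
Qed.

Let Zdist_positivity x y : Zdist x y = 0 -> x = y.
Proof.
move=> xy; rewrite -[x]reprK' -[y]reprK'; apply/nullP.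
by rewrite -xy; exact: cvg_dB.
Qed.

Let Zdist_sym x y : Zdist x y = Zdist y x.
Proof. by rewrite /Zdist; congr (lim _); under eq_fun do rewrite dBC. Qed.

Let Zdist_triangle y x z : Zdist x z <= Zdist x y + Zdist y z.
Proof.
rewrite -limD; [|exact: cvg_dB..].
apply: ler_lim; [exact: cvg_dB|apply: is_cvgD; exact: cvg_dB|].
by apply: nearW => k; exact: dB_triangle.
Qed.

HB.instance Definition _ := isMetric.Build R Zcompl
  Zdistxx Zdist_positivity Zdist_sym Zdist_triangle.

Let ZmulA_subproof (u : cauchy_seq) :
  (fun k => ZBmulA (u k)) \in cauchyB hb.
Proof.
have /asboolP cu : cauchy_val u \in cauchyB hb by case: u.
apply/asboolP => e e0 /=.
have b_gt0 : 0 < (Zindex B)%:R :> R by rewrite ltr0n.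
have [N HN] := cu _ (divr_gt0 e0 b_gt0); exists N => p q Np Nq.
have := HN p q Np Nq; rewrite ltr_pdivlMr // mulrC; apply: le_lt_trans.
by have := @dnuV R _ B (u p) (u q) uB b0 (ZBvalP (u p - u q)); rewrite invrK.
Qed.

Definition ZmulA (x : Zcompl) : Zcompl :=
  Zclass (MkCauchy (ZmulA_subproof (repr x))).

Let ZBcst_subproof (x : ZB) : (fun=> x) \in cauchyB hb.
Proof. by apply/asboolP => e e0; exists 0%N => p q _ _; rewrite /dB dnuxx. Qed.

Lemma Zdist_class (u v : cauchy_seq) :
  Zdist (Zclass u) (Zclass v) = lim (dB (u k) (v k) @[k --> \oo]).
Proof.
apply/esym/cvg_lim => //; rewrite -[Zdist _ _]addr0.
pose u' := repr (Zclass u); pose v' := repr (Zclass v).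
have uu' : dB (u k) (u' k) @[k --> \oo] --> 0 by apply/nullP; rewrite reprK'.
have vv' : dB (v k) (v' k) @[k --> \oo] --> 0 by apply/nullP; rewrite reprK'.
have -> : (fun k => dB (u k) (v k)) =
    (fun k => dB (u' k) (v' k) + (dB (u k) (v k) - dB (u' k) (v' k))).
  by apply/funext => k; rewrite addrC subrK.
apply: cvgD; first exact: cvg_dB.
apply/norm_cvg0P; apply: (@squeeze_cvgr _ _ _ _ (fun=> 0)
  (fun k => dB (u k) (u' k) + dB (v k) (v' k))).
- by apply: nearW => k; rewrite normr_ge0 dB_dist.
- exact: cvg_cst.
- by rewrite -[0 in X in _ --> X]addr0; exact: cvgD.
Qed.

Lemma ZmulA_class (u : cauchy_seq) :
  ZmulA (Zclass u) = Zclass (MkCauchy (ZmulA_subproof u)).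
Proof.
apply/nullP => /=; pose u' := repr (Zclass u).
have u'u : dB (u' k) (u k) @[k --> \oo] --> 0 by apply/nullP; rewrite reprK'.
apply: (@squeeze_cvgr _ _ _ _ (fun=> 0)
  (fun k => (Zindex B)%:R * dB (u' k) (u k))).
- apply: nearW => k; rewrite dnu_ge0 /=.
  have := @dnuV R _ B (u' k) (u k) uB b0 (ZBvalP (u' k - u k)).
  by rewrite invrK.
- exact: cvg_cst.
- by rewrite -(mulr0 (Zindex B)%:R); apply: cvgM => //; exact: cvg_cst.
Qed.

Definition ZBin (x : ZB) : Zcompl := Zclass (MkCauchy (ZBcst_subproof x)).

Definition nuZ (x : Zcompl) : \bar R := lim (nu B (repr x k) @[k --> \oo]).

(* Z^n[[B]] *)
Definition Zint : set Zcompl := [set x | (0 <= nuZ x)%E].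

(* K_A, with the product topology: that of the metric max(|x - x'|, d_B(y, y'))
   for the Euclidean norm or, equivalently, the sup norm of the library *)
Definition KA : Type := ('cV[R]_n.+1 * Zcompl)%type.

Definition KAmulA (p : KA) : KA := (map_mx ratr A *m p.1, ZmulA p.2).

Definition phi (x : ZB) : KA := (map_mx ratr (ZBval x), ZBin x).

(* |D| = a; D lies in Z^n[A], a subset of Z^n(B) *)
Definition digit_set (D : {fset ZB}) : Prop :=
  (forall d, d \in D -> Zpoly A d) /\ #|` D| = Zindex A.

Definition is_tile (D : {fset ZB}) (F : set KA) : Prop :=
  [/\ F !=set0, compact F &
      [set KAmulA p | p in F] =
      \bigcup_(d in [set` D]) [set p + phi d | p in F]].

End completion.

Notation borel T := (g_sigma_algebraType (@open T)).

Definition boundary (T : topologicalType) (F : set T) : set T :=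
  closure F `\` interior F.

(* Lebesgue measure on the Borel sets of R^(n+1), determined by the volumes of
   boxes *)
Definition is_lebesgue (R : realType) (n : nat)
    (lam : {measure set (borel 'cV[R]_n.+1) -> \bar R}) : Prop :=
  forall a b : 'cV[R]_n.+1, (forall i, a i 0 <= b i 0) ->
    lam [set x : 'cV[R]_n.+1 | forall i, a i 0 <= x i 0 <= b i 0] =
    (\prod_i (b i 0 - a i 0))%:E.

(* The Haar measure giving mass 1 to Z^n[[B]]; its regularity is automatic, as
   Z^n((B)) is locally compact and second countable. *)
Definition is_haar (R : realType) (n : nat) (A : 'M[rat]_n.+1)
    (hA : expanding R A) (hb : (1 < Zindex A^-1)%N)
    (muB : {measure set (borel (Zcompl hA hb)) -> \bar R}) : Prop :=
  [/\ forall (y : Zcompl hA hb) (E : set (borel (Zcompl hA hb))),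
        measurable E -> muB [set y + x | x in E] = muB E,
      forall K : set (Zcompl hA hb), compact K -> (muB K < +oo)%E &
      muB (@Zint R n A hA hb) = 1%E].

(* Main.v *)
(* Let N be the maximum of the norms on the two factors of K_A, and L the image
   of Z^n[A] under phi. Bounded parts of L are finite: if x lies in Z^n[A] and
     in
   A^m Z^n[B], the two expansions of x give a vector polynomial u over Z with
   u(A) = 0; dividing it by X - A and applying Gauss's lemma to
   chi_A g = adj(X - A) u bounds the denominator of x independently of x.

   Let X be compact with empty interior and A X in X + L. Then Y = X + L
     contains
   all A^k X, and Y is a locally finite union of closed nowhere dense sets.
   Periodicity under L and compactness of X yield one e > 0 such that each unit
   ball centered in Y contains an e-ball missing Y. Apply A^-k to these holes
     for
   a maximal separated family in A^k X: the holes are disjoint from X, lie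
   arbitrarily close to X, and their total measure is at least a fixed
     proportion
   of mu(X). Since the neighborhoods of X shrink to X, mu(X) = 0. This uses only
   the translation invariance of mu, neither its scaling under A nor |D| = a.

   The tile F satisfies A F in F + L, which gives (i) => (ii). So does its
   boundary, because A^-1 (int F + phi(d)) is an open subset of F for each digit
   d; hence the boundary is always null. If int F is nonempty, its closure is a
   nonempty closed set mapped into itself by the contractions
   x |-> A^-1 (x + phi(d)), so it contains F. *)

Require Import Defs.
From HB Require Import structures.
From mathcomp Require Import all_boot all_order all_algebra complex finmap.
From mathcomp Require Import all_classical all_reals all_analysis.
From mathcomp Require Import generic_quotient ring_quotient lra zify.

Set Implicit Arguments.
Unset Strict Implicit.
Unset Printing Implicit Defensive.

Import Order.TTheory GRing.Theory Num.Theory.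
Import numFieldNormedType.Exports numFieldTopology.Exports.

Local Open Scope classical_set_scope.
Local Open Scope ring_scope.

(** * Porous compact sets are null *)

(** These instances make products and matrices groups with a topology, so that the results on
    [group_norm] apply to K_A and to column vectors. *)
HB.instance Definition _ (U V : PreTopologicalZmodule.type) :=
  Topological.on (U * V)%type.
HB.instance Definition _ (U : PreTopologicalZmodule.type) m n :=
  Topological.on 'M[U]_(m, n).

(** Greedy selection: an element is kept exactly when [r] relates it to none of those kept so
    far. *)
Lemma separated_subseq (T : eqType) (r : rel T) (s : seq T) :
  reflexive r -> symmetric r ->
  exists t, [/\ subseq t s, pairwise (fun x y => ~~ r x y) t &
    {in s, forall x, exists2 y, y \in t & r x y}].
Proof.
move=> rr rs; elim: s => [|x s [t [ts pt st]]]; first by exists [::].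
have [/hasP[y yt rxy]|/hasPn nr] := boolP (has (r x) t).
  exists t; split=> // [|z]; first exact: subseq_trans (subseq_cons _ _).
  by rewrite inE => /predU1P[->|/st //]; exists y.
exists (x :: t); split=> [||z]; rewrite /= ?eqxx //.
  by rewrite pt andbT; apply/allP.
rewrite inE => /predU1P[->|/st[y yt rzy]]; first by exists x;
  rewrite ?inE ?eqxx.
by exists y; rewrite // inE yt orbT.
Qed.

Section measure_seq.
Context d (T : measurableType d) (R : realType) (mu : {measure set T ->
  \bar R}).
Variables (I : eqType) (E : I -> set T).
Hypothesis mE : forall i, measurable (E i).

(** Induction on the list: [A] is split into its parts inside and outside the first set. The same
    splitting gives the reverse bound for disjoint pieces below. *)
Lemma le_measure_seq_sup (s : seq I) (A : set T) : measurable A ->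
  A `<=` [set x | exists2 i, i \in s & E i x] ->
  (mu A <= \sum_(i <- s) mu (E i))%E.
Proof.
elim: s A => [|i s IH] A mA As.
  rewrite big_nil (_ : A = set0) ?measure0 // -subset0 => x Ax.
  have [k +] := As x Ax.
  by rewrite in_nil.
rewrite big_cons (measureDI mu mA (mE i)) addeC; apply: leeD.
  by apply: le_measure; rewrite ?inE //; exact: measurableI.
apply: IH; first exact: measurableD.
move=> x [Ax nE]; have [j] := As x Ax; rewrite inE => /predU1P[-> //|js] Ej.
by exists j.
Qed.

Lemma le_measure_seq_inf (s : seq I) (A : set T) : measurable A ->
  {in s, forall i, E i `<=` A} ->
  pairwise (fun i j => `[< E i `&` E j = set0 >]) s ->
  (\sum_(i <- s) mu (E i) <= mu A)%E.
Proof.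
elim: s A => [|i s IH] A mA sA /=; first by rewrite big_nil measure_ge0.
move=> /andP[/allP is0 ps]; rewrite big_cons (measureDI mu mA (mE i)) addeC.
rewrite setIidr; last by apply: sA; rewrite mem_head.
apply: leeD => //; apply: IH => //; first exact: measurableD.
move=> j js x Ej; split; first by apply: (sA j) => //; rewrite inE js orbT.
by move=> Ei; have /asboolP ij := is0 j js; suff : set0 x by []; rewrite -ij.
Qed.

End measure_seq.

(** * Topological groups whose neighborhoods are the balls of a norm *)

Section group_norm.
Context {R : realType} {G : PreTopologicalZmodule.type} (N : G -> R).

(** Stated for an abstract group so that it serves R^n, Z^n((B)) and K_A alike. The last clause ties
    the norm to the given topology; definiteness is a separate hypothesis of
    [group_norm_hausdorff]. *)
Definition group_norm : Prop :=
  [/\ N 0 = 0, forall x, N (- x) = N x, forall x y, N (x + y) <= N x + N y &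
      forall (p : G) (U : set G),
        nbhs p U <-> exists2 e, 0 < e & forall q, N (q - p) < e -> U q].

Definition nball (p : G) (e : R) : set G := [set q | N (q - p) < e].

Hypothesis hN : group_norm.

Let N0 : N 0 = 0. Proof. by case: hN. Qed.
Let NN x : N (- x) = N x. Proof. by case: hN. Qed.
Let ND x y : N (x + y) <= N x + N y. Proof. by case: hN. Qed.

Lemma group_norm_distC x y : N (x - y) = N (y - x).
Proof. by rewrite -opprB NN. Qed.

Lemma group_norm_tri z x y : N (x - y) <= N (x - z) + N (z - y).
Proof. by rewrite (le_trans _ (ND _ _)) // addrA subrK. Qed.

Lemma group_norm_ge0 x : 0 <= N x.
Proof. by have := ND x (- x); rewrite subrr N0 NN; lra. Qed.

Lemma nbhs_normP (p : G) (U : set G) :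
  nbhs p U <-> exists2 e, 0 < e & nball p e `<=` U.
Proof. by case: hN => _ _ _; exact. Qed.

Lemma nball_center p e : 0 < e -> nball p e p.
Proof. by rewrite /nball /= subrr N0. Qed.

Lemma open_nball p e : open (nball p e).
Proof.
rewrite openE => q /= pq; apply/nbhs_normP; exists (e - N (q - p)).
  by rewrite subr_gt0.
by move=> z; rewrite /nball /= => zq; have := group_norm_tri q z p; lra.
Qed.

Lemma compact_nball_cover (X : set G) (r : G -> R) : compact X ->
  (forall p, 0 < r p) ->
  exists s : seq G, {in s, forall p, X p} /\
    X `<=` [set q | exists2 p, p \in s & nball p (r p) q].
Proof.
(* [cover_compact] is stated for pointed spaces; [0] serves as the point. *)
pose G' : ptopologicalType :=
  HB.pack (G : Type) (Topological.on G) (isPointed.Build G 0).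
move=> cX r0; have {}cX : @cover_compact G' X by rewrite -compact_cover.
have [|p Xp|s sX Xs] := cX _ X (fun p => nball p (r p)).
- by move=> p _; exact: open_nball.
- by exists p => //; exact: nball_center.
exists s; split=> [p ps|q /Xs[p ps pq]]; last by exists p.
by have := sX _ ps; rewrite inE.
Qed.

Lemma compact_group_norm_bounded (X : set G) (y : G) : compact X ->
  exists r, forall x, X x -> N (x - y) < r.
Proof.
move=> cX; have [//|s [_ sX]] := @compact_nball_cover X (fun=> 1) cX.
exists (\sum_(p <- s) N (p - y) + 1) => x /sX[p ps].
rewrite /nball /= => xp; have := group_norm_tri p x y => H.
suff : N (p - y) <= \sum_(p <- s) N (p - y) by lra.
elim: s ps {sX} => // q s IH; rewrite inE big_cons => /predU1P[->|/IH].
  by rewrite lerDl sumr_ge0 // => ? _; exact: group_norm_ge0.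
by have := group_norm_ge0 (q - y); lra.
Qed.

(** The translates [X + l] are avoided one after the other: the current ball contains a point off
    the next translate, hence a smaller ball off this closed set. *)
Lemma nball_setD_translates (X : set G) (s : seq G) (p : G) (e : R) :
  closed X -> interior X = set0 -> 0 < e ->
  exists q e', [/\ 0 < e', nball q e' `<=` nball p e &
    forall l, l \in s -> forall z, nball q e' z -> ~ X (z - l)].
Proof.
move=> clX intX e0; elim: s => [|l s [q [e' [e'0 sub disj]]]].
  by exists p, e; split.
have [z qz nXz] : exists2 z, nball q e' z & ~ X (z - l).
  apply/not_exists2P => H; have : interior X (q - l).
    apply/nbhs_normP; exists e' => // z; rewrite /nball /= => zq.
    have := H (z + l); rewrite /nball /= opprB addrA in zq *.
    by rewrite addrK => -[|/contrapT].
  by rewrite intX.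
have [r r0 rX] : exists2 r, 0 < r & nball (z - l) r `<=` ~` X.
  by apply/nbhs_normP; move/closed_openC : clX; rewrite openE; exact.
have qz' : 0 < e' - N (z - q) by rewrite subr_gt0.
exists z, (Num.min r (e' - N (z - q))); split.
- by rewrite lt_min r0.
- move=> y; rewrite /nball /= lt_min => /andP[_ yz]; apply: sub.
  by rewrite /nball /=; have := group_norm_tri z y q; lra.
move=> l'; rewrite inE => /predU1P[->|/disj H] y; rewrite /nball /= lt_min.
  by move=> /andP[yz _]; apply: rX; rewrite /nball /= opprB addrA subrK.
by move=> /andP[_ yz]; apply: H; rewrite /nball /=;
  have := group_norm_tri z y q; lra.
Qed.

Lemma group_norm_hausdorff : (forall x, N x = 0 -> x = 0) -> hausdorff_space G.
Proof.
move=> N00 p q pq; apply/eqP; rewrite -subr_eq0; apply/eqP/N00.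
apply: contrapT => /eqP nz; have Npq : 0 < N (p - q).
  by rewrite lt_neqAle eq_sym nz group_norm_ge0.
have nb x : nbhs x (nball x (N (p - q) / 2)).
  by apply/nbhs_normP; exists (N (p - q) / 2); rewrite ?divr_gt0.
have [z [pz qz]] := pq _ _ (nb p) (nb q); move: pz qz; rewrite /nball /=.
by have := group_norm_tri z p q; rewrite [N (p - z)]group_norm_distC; lra.
Qed.

(* Periodicity under [L] reduces to centers [p] in [X]; near such a [p], only
   finitely many translates of [X] matter. *)
Lemma uniform_holes (X L : set G) :
  compact X -> closed X -> interior X = set0 ->
  (forall l l', L l -> L l' -> L (l - l')) ->
  (forall r, finite_set (L `&` [set l | N l < r])) ->
  exists2 e, 0 < e & forall x l, X x -> L l ->
    exists s, nball s e `<=` nball (x + l) 1 /\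
      forall z, nball s e z -> forall l', L l' -> ~ X (z - l').
Proof.
move=> cX clX intX LB Lfin.
have [rX NX] := compact_group_norm_bounded 0 cX.
have hole p : exists e, exists q, [/\ 0 < e, nball q e `<=` nball p (1 / 2) &
    forall z, nball q e z -> forall l', L l' -> ~ X (z - l')].
  (* A translate [X + l'] that meets the ball of radius 1/2 about [p] has [N l' < N p + 1 + rX], so
     only finitely many matter. *)
  have /finite_seqP[s sE] := Lfin (N p + 1 + rX).
  have [|q [e [e0 qp qX]]] := @nball_setD_translates X s p (1 / 2) clX intX.
    by lra.
  exists e, q; split=> // z qz l' Ll' Xz; apply: (qX l') (Xz) => //.
  suff : [set` s] l' by [].
  rewrite -sE; split=> //=; have := NX _ Xz; rewrite subr0; have := qp _ qz.
  rewrite /nball /= => H1 H2.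
  have := ND (z - p) p; rewrite subrK; have := ND z (- (z - l')).
  by rewrite NN opprB addrCA subrr addr0; lra.
have /choice[e he] := hole.
have e0 p : 0 < Num.min (e p) (1 / 2).
  by rewrite lt_min; have [q []] := he p; lra.
have [s [_ sX]] := compact_nball_cover cX e0.
pose m := \big[Num.min/(1 / 2 : R)]_(p <- s) Num.min (e p) (1 / 2).
exists m.
  rewrite /m; elim/big_ind: _ => [|x y x0 y0|p _]; first by lra.
    by rewrite lt_min x0.
  exact: e0.
move=> x l Xx Ll; have [p ps px] := sX x Xx.
have [q [_ qp qX]] := he p.
have me : m <= e p.
  rewrite /m; elim: (s) ps => // p' t IH; rewrite inE big_cons ge_min.
  by case/predU1P => [->|/IH ->]; rewrite ?orbT // ge_min lexx.
have shift z : nball (q + l) m z -> nball q (e p) (z - l).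
  by rewrite /nball /= opprD addrA [z - l - q]addrAC => H;
    exact: lt_le_trans me.
(* The hole found near [p] is moved by [l]. Both [x] and the hole lie within 1/2 of [p], so the
   moved hole lies within 1 of [x + l]; it still misses [X + L] because [L] is a group. *)
exists (q + l); split=> z /shift qz.
  have := qp _ qz; move: px; rewrite /nball /= lt_min => /andP[_ xp] zp.
  have := group_norm_tri p (z - l) x; rewrite [N (p - x)]group_norm_distC.
  by rewrite (_ : z - (x + l) = z - l - x); [lra|rewrite opprD addrA addrAC].
move=> l' Ll' Xz; apply: (qX _ qz (l' - l)); first exact: LB.
by rewrite opprB addrA subrK.
Qed.

End group_norm.

(** * Compact sets [X] with empty interior and [A X] contained in [X + L] *)

Section expanding_porous.
Context {R : realType} {G : PreTopologicalZmodule.type} (N : G -> R).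
Hypothesis hN : group_norm N.
Variables (A B : G -> G).
Hypothesis Asub : forall x y, A (x - y) = A x - A y.
Hypothesis BK : cancel B A.
Hypothesis Alip : exists C, forall x, N (A x) <= C * N x.

Let iterAsub k x y : iter k A (x - y) = iter k A x - iter k A y.
Proof. by elim: k => //= k ->. Qed.

Let iterBK k : cancel (iter k B) (iter k A).
Proof. by elim: k => // k IH x; rewrite [iter _ B _]iterS iterSr BK IH. Qed.

Lemma iter_group_norm_lip k : exists2 C, 0 < C &
  forall x, N (iter k A x) <= C * N x.
Proof.
have [C HC] := Alip; pose C' := Num.max C 1.
exists (C' ^+ k); first by rewrite exprn_gt0 // lt_max ltr01 orbT.
elim: k => [|k IH] x /=; first by rewrite expr0 mul1r.
apply: (@le_trans _ _ (C' * N (iter k A x))).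
  rewrite (le_trans (HC _)) // ler_wpM2r ?(group_norm_ge0 hN) //.
  by rewrite le_max lexx.
by rewrite exprS -mulrA ler_wpM2l // le_max ler01 orbT.
Qed.

Lemma open_iter_nball k (c : G) (e : R) : open [set q | N (iter k A q - c) < e].
Proof.
have [C C0 HC] := iter_group_norm_lip k.
rewrite openE => q /= qc; apply/(nbhs_normP hN).
exists ((e - N (iter k A q - c)) / C); first by rewrite divr_gt0 // subr_gt0.
move=> z; rewrite /nball /= ltr_pdivlMr // mulrC => zq.
have := group_norm_tri hN (iter k A q) (iter k A z) c.
by have := HC (z - q); rewrite iterAsub; lra.
Qed.

(** The measure lives on [T] with a map [i] to [G]: on K_A the product of the two Borel
    sigma-algebras is carried by a type other than the topological group, and [i] is the identity
    between them. Invariance enters through [mshift], for preimages of balls under powers of [A]. *)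
Context d (T : measurableType d) (mu : {measure set T -> \bar R}) (i : T -> G).
Hypothesis mopen : forall U : set G, open U -> measurable (i @^-1` U).
Hypothesis mshift : forall k e p,
  mu (i @^-1` [set q | N (iter k A (q - p)) < e]) =
  mu (i @^-1` [set q | N (iter k A q) < e]).

Let Enbr (X : set G) e : set G := [set q | exists2 x, X x & nball N x e q].

Let open_Enbr X e : open (Enbr X e).
Proof.
rewrite [Enbr _ _](_ : _ = \bigcup_(x in X) nball N x e).
  by apply: bigcup_open => x _; exact: open_nball.
by apply/seteqP; split.
Qed.

Let mE k c e : measurable (i @^-1` [set q | N (iter k A q - c) < e]).
Proof. by apply: mopen; exact: open_iter_nball. Qed.

Let muE k c e : mu (i @^-1` [set q | N (iter k A q - c) < e]) =
  mu (i @^-1` [set q | N (iter k A q) < e]).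
Proof.
(* Every center [c] is the image of [iter k B c] under [A^k], which reduces the claim to a
   translation. *)
rewrite -(mshift k e (iter k B c)); congr (mu (i @^-1` _)).
by apply/funext => q; rewrite /= iterAsub iterBK.
Qed.

Let sume_const (I : Type) (s : seq I) (v : \bar R) :
  (\sum_(p <- s) v = (size s)%:R%:E * v)%E.
Proof.
elim: s => [|p s IH]; rewrite ?big_nil ?mul0e // big_cons IH /= -natr1.
by rewrite EFinD ge0_muleDl ?mul1e ?lee_fin // addeC.
Qed.

Hypothesis Aexp : forall e : R, 0 < e ->
  exists k, forall x, N (iter k A x) < 1 -> N x < e.
Hypothesis tot_bounded : forall e : R, 0 < e ->
  exists s : seq G, nball N 0 3 `<=` [set q | exists2 p, p \in s &
    nball N p e q].
Hypothesis mu_fin : exists2 r : R, 0 < r & (mu (i @^-1` nball N 0%R r) < +oo)%E.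

Variables (X L : set G).
Hypothesis cX : compact X.
Hypothesis clX : closed X.
Hypothesis intX : interior X = set0.
Hypothesis Lsub : forall l l', L l -> L l' -> L (l - l').
Hypothesis Lfin : forall r, finite_set (L `&` [set l | N l < r]).
Hypothesis AL : forall l, L l -> L (A l).
Hypothesis AX : forall x, X x -> exists2 l, L l & X (A x - l).

Let mX : measurable (i @^-1` X).
Proof.
rewrite (_ : i @^-1` X = ~` (i @^-1` (~` X)));
  last by rewrite preimage_setC setCK.
by apply: measurableC; exact: mopen (closed_openC clX).
Qed.

Let iterAX k x : X x -> exists2 l, L l & X (iter k A x - l).
Proof.
move=> Xx; elim: k => [|k [l Ll Xl]] /=.
  by have [l Ll _] := AX Xx; exists 0; rewrite ?subr0 // -(subrr l);
    exact: Lsub.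
have [l' Ll' Xl'] := AX Xl; exists (A l + l').
  have L0 : L 0 by rewrite -(subrr l); exact: Lsub.
  by rewrite -[l']opprK; apply: Lsub; [exact: AL|rewrite -sub0r; exact: Lsub].
by rewrite opprD addrA -Asub.
Qed.

(* [M] is the number of balls, of the radius of the holes, covering a 3-ball. *)
Lemma porous_ineq : exists M : nat, forall e : R, 0 < e ->
  (M%:R%:E * mu (i @^-1` X) + mu (i @^-1` X) <=
    M%:R%:E * mu (i @^-1` Enbr X e))%E.
Proof.
have [e e0 holes] := uniform_holes hN cX clX intX Lsub Lfin.
have [s sP] := tot_bounded e0; exists (size s) => dl dl0.
(* For this [k] the map [A^-k] shrinks unit balls to radius [dl], so a hole within 1 of [A^k p]
   pulls back to within [dl] of [p]. *)
have [k Ak] := Aexp dl0.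
have /choice[h hP] p : exists q, X p ->
  nball N q e `<=` nball N (iter k A p) 1 /\
    forall z, nball N q e z -> forall l, L l -> ~ X (z - l).
  have [Xp|] := pselect (X p); last by move=> nXp; exists 0.
  have [l Ll Xl] := iterAX k Xp; have [q] := holes _ _ Xl Ll.
  by rewrite subrK; exists q.
pose v := mu (i @^-1` [set q | N (iter k A q) < e]).
have [u [uX Xu]] : exists u : seq G, {in u, forall p, X p} /\
    X `<=` [set q | exists2 p, p \in u & N (iter k A q - iter k A p) < 1].
  have [C C0 HC] := iter_group_norm_lip k.
  have [|u [uX Xu]] := @compact_nball_cover _ _ _ hN X (fun=> C^-1) cX.
    by move=> _; rewrite invr_gt0.
  exists u; split=> // q /Xu[p pu]; rewrite /nball /= => qp; exists p => //.
  rewrite -iterAsub (le_lt_trans (HC _)) //.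
  by rewrite -(mulfV (lt0r_neq0 C0)) ltr_pM2l.
(* The points of [t] have images under [A^k] at mutual distance at least 2, and every point of the
   1-net [u] is within 2 of one of them. *)
have [||t [tu pt ut]] := @separated_subseq _ (fun x y =>
  N (iter k A x - iter k A y) < 2) u.
- by move=> x; rewrite subrr; case: hN => -> _ _ _; lra.
- by move=> x y; rewrite (group_norm_distC hN).
have tX : {in t, forall p, X p} by move=> p /(mem_subseq tu)/uX.
(* Since 3 = 1 + 2, the 3-balls about the images of [t] cover [A^k X]; each is covered by [size s]
   balls of radius [e], all of which pull back to measure [v]. *)
have le1 : (mu (i @^-1` X) <= (size s)%:R%:E * \sum_(p <- t) v)%E.
  rewrite ge0_sume_distrr; last by move=> ? _; exact: measure_ge0.
  apply: le_trans (@le_measure_seq_sup _ _ _ mu _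
    (fun p => i @^-1` [set q | N (iter k A q - iter k A p) < 3]) _ t _ mX _) _.
  - by move=> p; exact: mE.
  - move=> x /Xu[p /ut[p' p't pp'] xp]; exists p' => //=.
    by have := group_norm_tri hN (iter k A p) (iter k A (i x)) (iter k A p');
      lra.
  apply: lee_sum => p _; rewrite -sume_const.
  apply: le_trans (@le_measure_seq_sup _ _ _ mu _
    (fun q => i @^-1` [set z | N (iter k A z - (iter k A p + q)) < e]) _ s _ _
      _) _.
  - by move=> q; exact: mE.
  - exact: mE.
  - move=> x /= xp; have [|q qs xq] := sP (iter k A (i x) - iter k A p).
      by rewrite /nball /= subr0.
    by exists q => //=; rewrite opprD addrA.
  by apply: lee_sum => q _; rewrite muE.
(* [None] stands for [X] and [Some p] for the hole near [A^k p]. The holes lie in unit balls with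
   2-separated centers, hence are disjoint, and they miss [X + L], which contains [A^k X]. *)
have le2 : (mu (i @^-1` X) + \sum_(p <- t) v <= mu (i @^-1` Enbr X dl))%E.
  pose E (o : option G) := if o is Some p then
    i @^-1` [set q | N (iter k A q - h p) < e] else i @^-1` X.
  have mEE o : measurable (E o) by case: o => [p|] //; exact: mE.
  have := @le_measure_seq_inf _ _ _ mu _ E mEE (None :: map Some t) (i @^-1`
    Enbr X dl).
  rewrite big_cons big_map /=; under [X in (_ + X)%E]eq_bigr do rewrite muE.
  apply.
  - by apply: mopen; exact: open_Enbr.
  - move=> o; rewrite inE => /predU1P[-> x Xx|/mapP[p pt' -> x Ex]].
      by exists (i x) => //; exact: nball_center.
    have [sub _] := hP p (tX p pt'); exists p; first exact: tX.
    by apply: Ak; rewrite iterAsub; exact: sub.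
  apply/andP; split.
    apply/allP => o /mapP[p /tX Xp ->]; apply/asboolP;
      rewrite -subset0 => x [/= Xx Ex].
    have [_ /(_ _ Ex)nX] := hP p Xp.
    have [l Ll Xl] := iterAX k Xx; exact: nX Ll Xl.
  rewrite pairwise_map; apply: (@sub_in_pairwise _ (mem t) _ _ _ t _ pt) =>
    [p q pt' qt /= pq|]; last exact/allP.
  apply/asboolP; rewrite -subset0 => x [/= px qx].
  have [/(_ _ px) + _] := hP p (tX p pt');
    have [/(_ _ qx) + _] := hP q (tX q qt).
  rewrite /nball /= => {}qx {}px; case/negP: pq.
  have := group_norm_tri hN (iter k A (i x)) (iter k A p) (iter k A q).
  by rewrite [N (_ p - _ (i x))](group_norm_distC hN); lra.
have M0 : (0 <= (size s)%:R%:E :> \bar R)%E by rewrite lee_fin.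
apply: le_trans (lee_wpmul2l M0 le2).
rewrite ge0_muleDr; [exact: leeD|exact: measure_ge0|].
by apply: sume_ge0 => *; exact: measure_ge0.
Qed.

(** As [e] tends to 0 in [porous_ineq], the neighborhoods decrease to the closed set [X], so M mu(X)
    + mu(X) <= M mu(X); as mu(X) is finite, it vanishes. *)
Lemma porous_null : mu (i @^-1` X) = 0%E.
Proof.
have [M MP] := porous_ineq; have [r r0 rfin] := mu_fin.
have [|s [_ Xs]] := @compact_nball_cover _ _ _ hN X (fun=> r / 2) cX.
  by move=> _; rewrite divr_gt0.
(* Starting at radius [r / 2] puts [F 0] inside finitely many balls of radius [r], which have finite
   measure; continuity from above requires this. *)
pose F j := i @^-1` Enbr X (r / 2 / j.+1%:R).
have e0 j : 0 < r / 2 / j.+1%:R by rewrite !divr_gt0.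
have XE : i @^-1` X = \bigcap_j F j.
  apply/seteqP; split=> x /=.
    by move=> Xx j _; exists (i x) => //; exact: nball_center.
  move=> Fx; apply: contrapT => nXx.
  have [e e0' eX] : exists2 e, 0 < e & nball N (i x) e `<=` ~` X.
    by apply/(nbhs_normP hN); move/closed_openC : clX; rewrite openE; exact.
  have [j jP] : exists j : nat, r / 2 / j.+1%:R < e.
    have e'0 : 0 < e / (r / 2) by rewrite !divr_gt0.
    have [m _ /(_ m (leqnn m))] := near_infty_natSinv_lt (PosNum e'0).
    by exists m; rewrite mulrC -ltr_pdivlMr ?divr_gt0.
  have [y Xy] := Fx j I; rewrite /nball /= => xy; apply: (eX y) => //.
  by rewrite /nball /= (group_norm_distC hN) (lt_trans xy).
have Foo : (mu (F 0%N) < +oo)%E.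
  apply: le_lt_trans (@le_measure_seq_sup _ _ _ mu _
    (fun p => i @^-1` [set q | N (iter 0 A q - p) < r]) _ s _ _ _) _.
  - by move=> p; exact: mE.
  - by apply: mopen; exact: open_Enbr.
  - move=> x [y /Xs[p ps py]]; rewrite /nball /= divr1 in py * => xy.
    by exists p => //=; have := group_norm_tri hN y (i x) p; lra.
  apply: lte_sum_pinfty => p _; rewrite muE /=.
  by move: rfin; rewrite /nball; under eq_fun do rewrite subr0.
have cvgF : mu \o F @ \oo --> mu (i @^-1` X).
  rewrite XE; apply: nonincreasing_cvg_mu => //.
  - by move=> j; apply: mopen; exact: open_Enbr.
  - by rewrite -XE.
  move=> j j' jj'; apply/subsetPset => x [y Xy xy]; exists y => //.
  apply: lt_le_trans xy _; rewrite ler_pM2l ?divr_gt0 //.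
  by rewrite lef_pV2 ?posrE // ler_nat.
have Xfin : mu (i @^-1` X) \is a fin_num.
  rewrite ge0_fin_numE // (le_lt_trans _ Foo) // le_measure ?inE //.
    by apply: mopen; exact: open_Enbr.
  by rewrite XE => x; apply.
have : (M%:R%:E * mu (i @^-1` X) + mu (i @^-1` X) <=
  M%:R%:E * mu (i @^-1` X))%E.
  have cM : (M%:R%:E * (mu \o F) j)%E @[j --> \oo] --> (M%:R%:E * mu (i @^-1`
    X))%E.
    exact: cvgeZl.
  rewrite -[leRHS](cvg_lim _ cM) //; apply: lime_ge; first by apply/cvg_ex;
    eexists; exact: cM.
  by apply: nearW => j; exact: MP.
have := fine_ge0 (measure_ge0 mu (i @^-1` X));
  rewrite -(fineK Xfin) -EFinM -EFinD lee_fin => H1 H2.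
by congr EFin; apply: le_anti; rewrite H1 andbT; lra.
Qed.

End expanding_porous.

(** * Tiles in a metric group *)

Section tile_topology.
Context {R : realType} {G : PreTopologicalZmodule.type} (N : G -> R).
Hypothesis hN : group_norm N.
Variables (A B : G -> G).
Hypothesis Asub : forall x y, A (x - y) = A x - A y.
Hypothesis AK : cancel A B.
Hypothesis BK : cancel B A.
Hypothesis Alip : exists C, forall x, N (A x) <= C * N x.
Hypothesis Aexp : forall r e : R, 0 < e ->
  exists k, forall x, N (iter k A x) < r -> N x < e.

Variables (I : Type) (D : set I) (f : I -> G) (F : set G).
Hypothesis cF : compact F.
Hypothesis clF : closed F.
Hypothesis tileF :
  [set A p | p in F] = \bigcup_(d in D) [set p + f d | p in F].

Lemma tile_out x : F x -> exists2 d, D d & F (A x - f d).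
Proof.
move=> Fx; have [d Dd [y Fy yE]] : (\bigcup_(d in D) [set p + f d | p in F]) (A
  x).
  by rewrite -tileF; exists x.
by exists d; rewrite // -yE addrK.
Qed.

Let tile_in x d : D d -> F (A x - f d) -> F x.
Proof.
move=> Dd Fx; have [y Fy yE] : [set A p | p in F] (A x).
  by rewrite tileF; exists d => //; exists (A x - f d); rewrite // subrK.
by rewrite -(AK x) -yE AK.
Qed.

(** The Lipschitz map [x |-> A x - f d] sends a small ball about [x] into [F], and [tile_in] brings
    that ball back into [F]. *)
Lemma tile_interior_in x d : D d -> interior F (A x - f d) -> interior F x.
Proof.
move=> Dd /(nbhs_normP hN)[e e0 eF]; apply/(nbhs_normP hN).
have [C C0 HC] := iter_group_norm_lip hN Alip 1.
exists (e / C); first exact: divr_gt0.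
move=> z; rewrite /nball /= ltr_pdivlMr // mulrC => zx.
apply: (tile_in Dd); apply: eF; rewrite /nball /= opprB addrA subrK.
by rewrite -Asub (le_lt_trans (HC _)).
Qed.

Lemma tile_closure_interior : interior F !=set0 -> F = closure (interior F).
Proof.
move=> [y0 Fy0]; apply/seteqP; split; last first.
  rewrite {2}(closure_id F).1 //; exact: closureS (@interior_subset _ F).
(* The point [x'] shares its first [k] digits with [x] and continues with the interior point [y0];
   hence [A^k (x - x') + y0] is the [k]-th remainder of [x]. Remainders stay in the bounded set [F],
   so [x - x'] becomes small. *)
have approx k x : F x ->
    exists x', [/\ interior F x' & F (iter k A (x - x') + y0)].
  elim: k x => [|k IH] x Fx; first by exists y0; split; rewrite ?subrK.
  have [d Dd Fd] := tile_out Fx; have [y [Fy Fy']] := IH _ Fd.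
  exists (B (y + f d)); split; first by apply: (tile_interior_in Dd);
    rewrite BK addrK.
  by rewrite iterSr Asub BK opprD addrA [A x - y - f d]addrAC.
have [rF rFP] := compact_group_norm_bounded hN y0 cF.
move=> x Fx U /(nbhs_normP hN)[e e0 eU].
have [k Hk] := Aexp rF e0; have [x' [Fx' Fk]] := approx k x Fx.
exists x'; split=> //; apply: eU; rewrite /nball /= (group_norm_distC hN).
by apply: Hk; rewrite -[X in N X](addrK y0); exact: rFP.
Qed.

(** By [tile_interior_in], a remainder in the interior would force [x] into the interior. The
    boundary thus satisfies the hypothesis [AX] of [porous_null]. *)
Lemma boundary_tile_out x : boundary F x ->
  exists2 d, D d & boundary F (A x - f d).
Proof.
rewrite /boundary -(closure_id F).1 // => -[Fx nFx].
have [d Dd Fd] := tile_out Fx; exists d => //; split=> // iF.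
by apply: nFx; exact: tile_interior_in iF.
Qed.

End tile_topology.

Section boundary.
Context {T : topologicalType}.
Implicit Type F : set T.

Lemma closed_boundary F : closed (boundary F).
Proof. by apply: closedI; [exact:
  closed_closure|exact/open_closedC/open_interior]. Qed.

Lemma compact_boundary F : closed F -> compact F -> compact (boundary F).
Proof.
move=> clF cF; apply: subclosed_compact cF _; first exact: closed_boundary.
by rewrite /boundary -(closure_id F).1 // => x [].
Qed.

Lemma interior_boundary F : closed F -> interior (boundary F) = set0.
Proof.
move=> clF; rewrite -subset0 => x bx; have [_] := interior_subset bx; apply.
apply: interiorS bx; rewrite /boundary -(closure_id F).1 //; exact: subIsetl.
Qed.

End boundary.

(** * The representation space *)

Section valuation.
Context {R : realType} {n : nat} (M : 'M[rat]_n.+1).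
Hypotheses (uM : M \is a GRing.unit) (b1 : (1 < Zindex M)%N).

Local Notation b := ((Zindex M)%:R : R).

Let b_gt1 : 1 < b. Proof. by rewrite ltr1n. Qed.
Let b_gt0 : 0 < b. Proof. exact: lt_trans b_gt1. Qed.

(** The dictionary between metric and algebra: closed balls about 0 with radius a power of [b] are
    the steps of the filtration. *)
Lemma dnu_leP (k : int) y : Zlaurent M y ->
  dnu M y 0 <= b ^ (- k) <-> Zfilt M k y.
Proof.
move=> /(nu_gtNy (R := R) uM); rewrite /dnu subr0 => yN; split; last first.
  move=> ky; have : (k%:~R%:E <= nu M y :> \bar R)%E.
    apply: le_ereal_inf_tmp => _ [j nj <-]; rewrite lee_fin ler_int leNgt.
    by apply/negP => jk; apply: nj; apply: Zfilt_le ky => //; lia.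
  rewrite -powR_intmul ?(ltW b_gt0) // intrN.
  case: (nu M y) yN => [r _||//]; rewrite ?powR_ge0 // lee_fin => kr.
  by rewrite ler_powR ?lerN2 // ltW.
apply: contraPP => nk; apply/negP; rewrite -ltNge.
(* Because [nu] tests membership in step [k + 1], failure at step [k] bounds it by [k - 1], and the
   distance is at least [b ^ (1 - k) > b ^ (- k)]. *)
have : (nu M y <= (k - 1)%:~R%:E :> \bar R)%E.
  by apply: ereal_inf_lbound; exists (k - 1); rewrite /= ?subrK.
case: (nu M y) yN => [r _|//|//]; rewrite lee_fin => rk.
apply: lt_le_trans (_ : b `^ (- (k - 1)%:~R) <= _); last first.
  by rewrite ler_powR ?lerN2 // ltW.
rewrite -intrN powR_intmul ?(ltW b_gt0) // opprB addrC.
by rewrite exprzDr ?gt_eqF ?unitfE ?gt_eqF // expr1z ltr_pMr ?exprz_gt0.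
Qed.

Lemma le_nuM y : (nu M y + 1 <= nu M (M *m y) :> \bar R)%E.
Proof.
apply: le_ereal_inf_tmp => _ [k kMy <-]; rewrite -leeBrDr // -EFinB.
have -> : k%:~R - 1 = (k - 1)%:~R :> R by rewrite intrB.
apply: ereal_inf_lbound; exists (k - 1) => //=; rewrite subrK => ky.
by apply: kMy; have := Zfilt_mul 1 uM ky; rewrite expr1z addrC.
Qed.

(** Counterpart of [dnuV]: together they make [A] multiply distances by exactly [b], as used in
    [Zdist_ZmulA]. *)
Lemma dnuM x y : Zlaurent M (x - y) ->
  b * dnu M (M *m x) (M *m y) <= dnu M x y.
Proof.
move=> /(nu_gtNy (R := R) uM); rewrite /dnu -mulmxBr; move: (le_nuM (x - y)).
case: (nu M (M *m _)) => [r||]; last 2 first.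
- by move=> _ _; rewrite mulr0; exact: dnu_ge0.
- by case: (nu M (x - y)).
case: (nu M (x - y)) => [s||//] //=; rewrite -EFinD lee_fin => sr _.
rewrite -{1}[b](powRr1 (ltW b_gt0)) -powRD ?pnatr_eq0 ?gtn_eqF ?implybT ?(ltnW
  b1) //.
by rewrite ler_powR ?(ltW b_gt1) //; lra.
Qed.

End valuation.

(** * Finite systems of coset representatives *)

Section cosets.
Context {n : nat} (M : 'M[rat]_n.+1).
Hypotheses (uM : M \is a GRing.unit) (b0 : (0 < Zindex M)%N).

Let Zpoly0 : Zpoly M 0.
Proof.
by exists 0%N, (fun=> 0); rewrite big1 // => i _; rewrite raddf0 mulmx0.
Qed.

Lemma Zpoly_cosets : exists s : seq 'cV[rat]_n.+1, forall x, Zpoly M x ->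
  exists2 p, p \in s & Zpoly M p /\ exists2 y, Zpoly M y & x - p = M *m y.
Proof.
pose c (x : 'cV[rat]_n.+1) := [set x + M *m y | y in Zpoly M].
(* On an infinite set [fset_set] is empty, so a positive index means finitely many cosets. *)
have fin : finite_set (c @` Zpoly M).
  apply: contrapT => nfin; move: b0.
  by rewrite /Zindex /fset_set; case: pselect => //; rewrite cardfs0.
have [s sE] := (finite_seqP _).1 fin.
have /choice[h hP] C : exists x, (c @` Zpoly M) C -> Zpoly M x /\ c x = C.
  have [[x Zx <-]|] := pselect ((c @` Zpoly M) C); first by exists x.
  by move=> nC; exists 0.
exists (map h s) => x Zx; have cx : (c @` Zpoly M) (c x) by exists x.
have [Zh ch] := hP _ cx; exists (h (c x)).
  by apply: map_f; move: cx; rewrite sE.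
split=> //; have [y Zy yE] : c (h (c x)) x.
  by rewrite ch; exists 0; rewrite // mulmx0 addr0.
exists y => //; have := congr1 (fun z => z - h (c x)) yE.
by rewrite addrAC subrr add0r => ->.
Qed.

(** Representatives are built digit by digit: the remainder at level [j + m] is reduced by one more
    representative of [Zpoly M] modulo [M]. *)
Lemma Zfilt_cosets (j : int) (m : nat) : exists s : seq 'cV[rat]_n.+1,
  forall x, Zfilt M j x -> exists2 p, p \in s &
    Zfilt M j p /\ Zfilt M (j + m) (x - p).
Proof.
elim: m => [|m [s sP]].
  exists [:: 0] => x jx; exists 0; first by rewrite inE.
  split; first by exists 0; rewrite ?mulmx0.
  by rewrite !subr0.
have [t tP] := Zpoly_cosets.
exists [seq p + M ^ (j + m) *m q | p <- s, q <- t] => x jx.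
have [p ps [jp [y Zy yE]]] := sP x jx.
have [q qt [Zq [z Zz zE]]] := tP y Zy.
exists (p + M ^ (j + m) *m q); first by apply/allpairsP; exists (p, q).
split.
  rewrite -[_ *m q]opprK; apply: Zfilt_sub => //; rewrite -sub0r.
  apply: Zfilt_sub; first by exists 0; rewrite ?mulmx0.
  by apply: (@Zfilt_le _ _ j (j + m)) => //; [rewrite lerDl|exists q].
exists z => //; rewrite opprD addrA -yE -mulmxBr zE mulmxA.
have ME : M ^ (j + m.+1) = M ^ (j + m) * M.
  by rewrite -{3}[M]expr1z -exprzDr // -addrA -PoszD addn1.
by rewrite ME.
Qed.

End cosets.

(** * Group structure, distance and multiplication by A on the completion *)

Section representation_space.
Context {R : realType} {n : nat} {A : 'M[rat]_n.+1}.
Context {hA : expanding R A} {hb : (1 < Zindex A^-1)%N}.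

Local Notation B := (A^-1).
Local Notation b := ((Zindex A^-1)%:R : R).
Local Notation Zc := (Zcompl hA hb).
(* The canonical group structure of [ZB hA] also depends on [hb], which cannot
   be inferred from [ZB hA] alone. *)
Local Notation ZBg := (Defs_ZB__canonical__Algebra_Zmodule hA hb).
Implicit Types (u v : cauchy_seq hA hb) (x y z : Zc).

Let uB : B \is a GRing.unit.
Proof. by rewrite unitrV; exact: expanding_unit hA. Qed.

Let b0 : (0 < Zindex B)%N. Proof. exact: ltnW hb. Qed.

Let b_gt0 : 0 < b. Proof. by rewrite ltr0n. Qed.

Lemma Zlaurent_sub (p q : ZB hA) : Zlaurent B (ZBval p - ZBval q).
Proof. exact: (ZBvalP ((p : ZBg) - (q : ZBg))). Qed.

Lemma dB_sub (p q r : ZBg) : dB (p - r) (q - r) = dB p q.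
Proof. by rewrite /dB /dnu /= opprB addrA subrK. Qed.

Lemma ZclassB u v : Zclass (u - v) = Zclass u - Zclass v.
Proof. exact: (raddfB (\pi_Zc)%qT). Qed.

Lemma Zclass_surj x : exists u, x = Zclass u.
Proof. by exists (repr x); rewrite /Zclass reprK. Qed.

Lemma Zclass0 : Zclass (0 : cauchy_seq hA hb) = 0.
Proof. exact: (raddf0 (\pi_Zc)%qT). Qed.

Lemma Zdist_tri y x z : Zdist x z <= Zdist x y + Zdist y z.
Proof. exact: (@metric_triangle _ Zc). Qed.

Lemma ZdistC x y : Zdist x y = Zdist y x.
Proof. exact: (@metric_sym _ Zc). Qed.

Lemma Zdistxx x : Zdist x x = 0. Proof. exact: (@mdistxx _ Zc). Qed.

Lemma dB_triangle (q p r : ZBg) : dB p r <= dB p q + dB q r.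
Proof.
have H : dB (p - q) (r - q) <=
  Num.max (dB (p - q) (0 : ZBg)) (dB (r - q) (0 : ZBg)).
  by apply: dnu_ultra => //; exact: ZBvalP.
rewrite !dB_sub in H; apply: le_trans H _.
have E (s : ZBg) : dB (s - q) (0 : ZBg) = dB s q by rewrite -(subrr q) dB_sub.
by rewrite !E (_ : dB q r = dB r q) ?[dB q r]dnuC // ge_max lerDl lerDr
  !dnu_ge0.
Qed.

Lemma cvg_dB u v : dB (u k) (v k) @[k --> \oo] --> Zdist (Zclass u) (Zclass v).
Proof.
rewrite Zdist_class; apply/cauchy_cvgP/cauchy_exP => e e0.
have e2 : 0 < e / 2 by rewrite divr_gt0.
have [/asboolP/(_ _ e2)[p Hp] /asboolP/(_ _ e2)[q Hq]] :
  cauchy_val u \in cauchyB hb /\ cauchy_val v \in cauchyB hb by case: u v =>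
    ? ? [].
pose m := maxn p q; exists (dB (u m) (v m)); exists m => // k /= mk.
have pm : (p <= m)%N := leq_maxl _ _; have qm : (q <= m)%N := leq_maxr _ _.
have pk := leq_trans pm mk; have qk := leq_trans qm mk.
have := dB_triangle (u m) (u k) (v k); have := dB_triangle (v m) (u m) (v k).
have := dB_triangle (u k) (u m) (v m); have := dB_triangle (v k) (u k) (v m).
have := Hp _ _ pm pk; have := Hp _ _ pk pm; have := Hq _ _ qm qk;
  have := Hq _ _ qk qm.
by rewrite /ball /= => *; rewrite ltr_norml; apply/andP; split; lra.
Qed.
Arguments cvg_dB : clear implicits.

Lemma Zdist_eq_lim u v (l : R) :
  dB (u k) (v k) @[k --> \oo] --> l -> Zdist (Zclass u) (Zclass v) = l.
Proof. by rewrite Zdist_class => /cvg_lim; apply; exact: Rhausdorff. Qed.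

Lemma Zdist_shift x y z : Zdist (x - z) (y - z) = Zdist x y.
Proof.
have [u ->] := Zclass_surj x; have [v ->] := Zclass_surj y.
have [w ->] := Zclass_surj z; rewrite -!ZclassB.
apply: Zdist_eq_lim.
by under eq_fun do rewrite dB_sub; exact: cvg_dB.
Qed.

Lemma Zdist_sub0 x y : Zdist (x - y) 0 = Zdist x y.
Proof. by rewrite -(subrr y) Zdist_shift. Qed.

Lemma ZmulAB x y : ZmulA (x - y) = ZmulA x - ZmulA y.
Proof.
have [u ->] := Zclass_surj x; have [v ->] := Zclass_surj y.
rewrite -ZclassB !ZmulA_class -ZclassB; congr Zclass.
by apply/val_inj/funext => k; apply/val_inj; rewrite /= mulmxBr.
Qed.

Lemma Zdist_ZmulA x y : Zdist (ZmulA x) (ZmulA y) = b * Zdist x y.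
Proof.
have [u ->] := Zclass_surj x; have [v ->] := Zclass_surj y.
rewrite !ZmulA_class; apply: Zdist_eq_lim.
rewrite (_ : (fun k => _) = (fun k => b * dB (u k) (v k))).
  by apply: cvgM; [exact: cvg_cst|exact: cvg_dB].
apply/funext => k; rewrite /dB /=; apply/le_anti/andP; split.
  have := @dnuV R _ B (u k) (v k) uB b0 (Zlaurent_sub _ _).
  by rewrite invrK.
have uA : A \is a GRing.unit := expanding_unit hA.
have := @dnuM R _ B uB hb (A *m u k) (A *m v k).
have BA : B *m A = 1%:M := mulVr uA.
rewrite !mulmxA BA !mul1mx; apply.
exact: (Zlaurent_sub (ZBmulA (u k)) (ZBmulA (v k))).
Qed.

(** A preimage is obtained by applying [B] termwise to a Cauchy sequence; by [dnuM] this contracts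
    distances, so the result is again Cauchy. *)
Lemma ZmulA_surj y : exists x, ZmulA x = y.
Proof.
have [u ->] := Zclass_surj y.
have uA : A \is a GRing.unit := expanding_unit hA.
have Bmem (p : ZB hA) : B *m ZBval p \in ZBpred hA.
  have /(ZlaurentE _ uB)[k kp] := ZBvalP p.
  apply/asboolP/(ZlaurentE _ uB); exists k.
  apply: (@Zfilt_le _ _ _ (1 - k%:Z)) => //; first by lia.
  by have := Zfilt_mul 1 uB kp; rewrite expr1z.
pose v k := MkZB (Bmem (u k)).
have cv : v \in cauchyB hb.
  apply/asboolP => e e0; have /asboolP/(_ _ (mulr_gt0 b_gt0 e0))[m Hm] :
    cauchy_val u \in cauchyB hb by case: u {v}.
  exists m => p q mp mq; rewrite -(ltr_pM2l b_gt0).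
  apply: le_lt_trans (Hm p q mp mq).
  by apply: dnuM => //; exact: (Zlaurent_sub (u p) (u q)).
exists (Zclass (MkCauchy cv)); rewrite ZmulA_class; congr Zclass.
apply/val_inj/funext => k; apply/val_inj.
have AB : A *m B = 1%:M := mulrV uA.
by rewrite /= mulmxA AB mul1mx.
Qed.

Lemma ZBinB (p q : ZBg) : ZBin hb (p - q) = ZBin hb p - ZBin hb q.
Proof. by rewrite /ZBin -ZclassB; congr Zclass; apply/val_inj/funext. Qed.

Lemma Zdist_ZBin (p q : ZBg) : Zdist (ZBin hb p) (ZBin hb q) = dB p q.
Proof.
by rewrite /ZBin; apply: Zdist_eq_lim => /=; exact: cvg_cst.
Qed.

Lemma ZmulA_ZBin (p : ZB hA) : ZmulA (ZBin hb p) = ZBin hb (ZBmulA p).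
Proof. by rewrite /ZBin ZmulA_class; congr Zclass; apply/val_inj. Qed.

Lemma ZBin_dense x (e : R) : 0 < e -> exists p : ZB hA, Zdist (ZBin hb p) x < e.
Proof.
move=> e0; have [u ->] := Zclass_surj x.
have e2 : 0 < e / 2 by rewrite divr_gt0.
have /asboolP/(_ _ e2)[m Hm] : cauchy_val u \in cauchyB hb by case: u.
exists (u m); apply: (@le_lt_trans _ _ (e / 2)); last by lra.
have [c -> cE] : exists2 c, ZBin hb (u m) = Zclass c & forall k, c k = u m.
  by rewrite /ZBin; eexists.
apply: cvgr_to_le (cvg_dB c u) _; exists m => // k /= mk.
by rewrite cE; apply/ltW/Hm.
Qed.

End representation_space.
Arguments cvg_dB {R n A hA hb} u v.

(** * Total boundedness of balls, and Z^n[[B]] as the closed unit ball *)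

Section representation_space_balls.
Context {R : realType} {n : nat} {A : 'M[rat]_n.+1}.
Context {hA : expanding R A} {hb : (1 < Zindex A^-1)%N}.

Local Notation B := (A^-1).
Local Notation b := ((Zindex A^-1)%:R : R).
Local Notation Zc := (Zcompl hA hb).
Local Notation ZBg := (Defs_ZB__canonical__Algebra_Zmodule hA hb).

Let uB : B \is a GRing.unit.
Proof. by rewrite unitrV; exact: expanding_unit hA. Qed.

Let b_gt1 : 1 < b. Proof. by rewrite ltr1n. Qed.
Let b_gt0 : 0 < b. Proof. exact: lt_trans b_gt1. Qed.

Lemma ZBin0 : ZBin hb (0 : ZBg) = 0.
Proof. by rewrite -(subrr (0 : ZBg)) ZBinB subrr. Qed.

Lemma Zdist_ZBin0 (p : ZB hA) : Zdist (ZBin hb p) 0 = dnu B p 0.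
Proof. by rewrite -ZBin0 Zdist_ZBin. Qed.

Lemma expVn_small (e : R) : 0 < e -> exists m : nat, b ^- m < e.
Proof.
move=> e0; have : `|b^-1| < 1 by rewrite ger0_norm ?invr_ge0 ?ltW // invf_lt1.
move=> /cvg_expr/cvgrPdist_lt/(_ e e0)[m _ /(_ m (leqnn m))].
rewrite /= sub0r normrN exprVn ger0_norm; first by exists m.
by rewrite invr_ge0 exprn_ge0 // ltW.
Qed.

(** By density [z] may be replaced by a point of B^-m Z^n[B], a group with finitely many cosets
    modulo B^K Z^n[B], whose diameter is below [e / 2]. *)
Lemma Zball_totally_bounded (r e : R) : 0 < e ->
  exists s : seq Zc, forall z, Zdist z 0 < r ->
    exists2 p, p \in s & Zdist z p < e.
Proof.
move=> e0; have e'0 : 0 < Num.min (e / 2) 1 by rewrite lt_min ltr01 divr_gt0.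
have [m mr] : exists m : nat, r + 1 <= b ^+ m.
  have [|m] := @expVn_small (Num.max (r + 1) 1)^-1.
    by rewrite invr_gt0 lt_max ltr01 orbT.
  rewrite ltf_pV2 ?posrE ?exprn_gt0 ?lt_max ?ltr01 ?orbT // gt_max.
  by move=> /andP[/ltW]; exists m.
have [|K Ke] := @expVn_small (e / 2); first by rewrite divr_gt0.
have [s sP] := Zfilt_cosets uB (ltnW hb) (- m%:Z) (m + K).
(* [insubd] sends vectors outside Z^n(B) to 0; the representatives chosen below do lie in Z^n(B), as
   [qZ] records. *)
exists [seq ZBin hb (insubd (0 : ZBg) q) | q <- s] => z zr.
have [p pz] := ZBin_dense z e'0; move: pz; rewrite lt_min => /andP[pe p1].
have [|q qs [mq pq]] := sP (ZBval p).
  apply/(dnu_leP (R := R) uB hb); first exact: ZBvalP.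
  rewrite opprK -Zdist_ZBin0 (le_trans _ mr) //.
  by rewrite (le_trans (Zdist_tri z _ _)) // addrC lerD ?ltW.
exists (ZBin hb (insubd (0 : ZBg) q)); first exact: map_f.
have qZ : q \in ZBpred hA by apply/asboolP/(ZlaurentE _ uB); exists m.
rewrite (le_lt_trans (Zdist_tri (ZBin hb p) _ _)) // [e]splitr ltrD 1?ZdistC //.
apply: le_lt_trans Ke; rewrite ZdistC Zdist_ZBin /dB -dnuB0 insubdK // exprnN.
apply/(dnu_leP (R := R) uB hb); last by rewrite PoszD addKr in pq.
by have := Zlaurent_sub (hb := hb) p (insubd (0 : ZBg) q); rewrite /= insubdK.
Qed.

(** The valuation is minus the logarithm in base [b] of the distance to 0, first along the
    representing sequence and then, by continuity, in the limit. *)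
Lemma nuZ_lim (x : Zc) : nuZ x =
  if Zdist x 0 == 0 then +oo%E else (- (ln (Zdist x 0) / ln b))%:E.
Proof.
have lnb : 0 < ln b by rewrite ln_gt0.
pose f k : \bar R := nu B (repr x k); pose g k := dnu (R := R) B (repr x k) 0.
have fN k : f k != -oo%E by apply: nu_gtNy => //; exact: ZBvalP.
have gE k : g k = if f k is r%:E then b `^ (- r) else 0 by rewrite /g /dnu
  subr0.
have cvg_g : g k @[k --> \oo] --> Zdist x 0.
  have := cvg_dB (repr x) (0 : cauchy_seq hA hb).
  by rewrite Zclass0 /Zclass reprK.
have [L0|L0] := eqVneq (Zdist x 0) 0; apply: cvg_lim => //.
  apply/cvgeyPge => a.
  have : \forall k \near \oo, g k < b `^ (- a).
    by apply: (cvgr_lt _ cvg_g); rewrite L0 powR_gt0.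
  apply: filterS => k; rewrite gE -/(f k); case: (f k) (fN k) => [r _|_ _|//].
    by apply: contraTT; rewrite lee_fin -ltNge -leNgt => /ltW ra;
      rewrite ler_powR ?lerN2 // ltW.
  by rewrite leey.
have Lgt0 : 0 < Zdist x 0 by rewrite lt_neqAle eq_sym L0 (@mdist_ge0 _ Zc).
have : ((- (ln (g k) / ln b))%:E : \bar R) @[k --> \oo] --> (- (ln (Zdist x 0)
  / ln b))%:E.
  apply: cvg_EFin; first exact: nearW.
  apply: cvgN; apply: cvgM; last exact: cvg_cst.
  by apply: continuous_cvg cvg_g; exact: continuous_ln.
apply: cvg_trans; apply: near_eq_cvg.
(* Positivity of [g k] excludes the value [+oo] of [f k]. *)
have : \forall k \near \oo, 0 < g k by apply: (cvgr_gt _ cvg_g).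
apply: filterS => k; rewrite gE -/(f k); case: (f k) (fN k) => [r _ _|_|//].
  by rewrite ln_powR mulfK ?gt_eqF // opprK.
by rewrite ltxx.
Qed.

Lemma ZintE : @Zint R n A hA hb = [set x : Zc | Zdist x 0 <= 1].
Proof.
have lnb : 0 < ln b by rewrite ln_gt0.
apply/seteqP; split=> x; rewrite /Zint /= nuZ_lim; case: eqP => [-> //|/eqP L0].
  rewrite lee_fin oppr_ge0 pmulr_lle0 ?invr_gt0 //.
  by apply: contraLR; rewrite -!ltNge; exact: ln_gt0.
by rewrite lee_fin oppr_ge0 pmulr_lle0 ?invr_gt0 //; exact: ln_le0.
Qed.

End representation_space_balls.

(** * Lattice points in bounded sets *)

Section gauss.
Local Notation pZtoQ := (map_poly (intr : int -> rat)).

(** Gauss's lemma: write [p = p0 / a] with [p0] integral. The primitive part of [p0] divides [h]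
    over Z, so the content of [p0], which depends on [p] alone, clears the denominators of every
    cofactor [g]. *)
Lemma int_poly_cofactor_denominator (p : {poly rat}) : p != 0 ->
  exists2 q : int, q != 0 & forall (g : {poly rat}) (h : {poly int}),
    p * g = pZtoQ h -> exists r : {poly int}, q%:~R *: g = pZtoQ r.
Proof.
have [p0 [a a0 ->]] := rat_poly_scale p; set aQ : rat := a%:~R.
have aQ0 : aQ != 0 by rewrite intr_eq0.
rewrite scaler_eq0 invr_eq0 (negPf aQ0) /= => p0n0.
have p0n0' : p0 != 0 by apply: contraNneq p0n0 => ->; rewrite raddf0.
exists (zcontents p0); first by rewrite zcontents_eq0.
move=> g h pgh; have p0h : p0 %| h.
  suff : pZtoQ p0 %| pZtoQ h by rewrite dvdp_rat_int.
  by have := @dvdp_mulIl _ (pZtoQ p0) (aQ^-1 *: g);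
    rewrite -scalerAr scalerAl pgh.
have [r hE] := dvdpP_int p0h; exists (a *: r).
have p1n0 : pZtoQ (zprimitive p0) != 0.
  rewrite map_poly_eq0_id0 ?intr_eq0 ?lead_coef_eq0 ?zprimitive_eq0 //.
apply: (mulfI p1n0); rewrite map_polyZ -!scalerAr -rmorphM /= -hE -pgh.
rewrite -scalerAl scalerA mulfV // scale1r.
by rewrite [in RHS](zpolyEprim p0) map_polyZ -scalerAl.
Qed.

Lemma poly_common_denominator (I : finType) (P : I -> {poly rat}) :
  exists2 N : int, N != 0 &
    forall i, exists p : {poly int}, N%:~R *: P i = pZtoQ p.
Proof.
have /choice[a aP] i : exists a : int, a != 0 /\
    exists p : {poly int}, a%:~R *: P i = pZtoQ p.
  have [q [a a0 ->]] := rat_poly_scale (P i); exists a; split=> //.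
  by exists q; rewrite scalerA mulfV ?scale1r ?intr_eq0.
exists (\prod_i a i); first by apply/prodf_neq0 => i _; have [] := aP i.
move=> i; have [_ [p pE]] := aP i; exists ((\prod_(j | j != i) a j) *: p).
by rewrite (bigD1 i) //= mulrC intrM -scalerA pE map_polyZ.
Qed.

End gauss.

(** * Denominators of Horner quotients by X - A *)

Section common_denominator.
Context {n : nat}.
Local Notation intv := (map_mx (intr : int -> rat)).
Local Notation pZtoQ := (map_poly (intr : int -> rat)).
Implicit Type A : 'M[rat]_n.+1.

Lemma matrix_common_denominator (m : nat) (C : 'I_m -> 'M[rat]_n.+1) :
  exists2 N : int, N != 0 &
    forall i, exists c : 'M[int]_n.+1, N%:~R *: C i = intv c.
Proof.
have [N N0 NP] := poly_common_denominator
  (fun k : 'I_m * 'I_n.+1 * 'I_n.+1 => (C k.1.1 k.1.2 k.2)%:P).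
exists N => // k.
have /choice[c cP] (ij : 'I_n.+1 * 'I_n.+1) : exists c : int,
  N%:~R * C k ij.1 ij.2 = c%:~R.
  have [p pE] := NP (k, ij.1, ij.2); exists p`_0.
  by rewrite -coef_map -pE coefZ coefC.
exists (\matrix_(i, j) c (i, j)); apply/matrixP => i j.
by rewrite !mxE -(cP (i, j)).
Qed.

(* The partial sums are the coefficients of the quotient g of the vector
   polynomial u = sum u_i X^i by X - A; since chi_A g = adj(X - A) u, Gauss's
   lemma bounds their denominators. *)
Lemma horner_quotient_denominator A : exists2 q : int, q != 0 &
  forall (K : nat) (u : nat -> 'cV[int]_n.+1),
    \sum_(0 <= t < K) A ^+ t *m intv (u t) = 0 ->
  forall j, (j < K)%N -> exists w : 'cV[int]_n.+1,
    q%:~R *: (\sum_(j <= t < K) A ^+ (t - j) *m intv (u t)) = intv w.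
Proof.
pose C := char_poly_mx A.
have [q q0 qP] := int_poly_cofactor_denominator (monic_neq0 (char_poly_monic
  A)).
have [N N0 NP] := poly_common_denominator
  (fun ij : 'I_n.+1 * 'I_n.+1 => (\adj C) ij.1 ij.2).
(* [q] clears the cofactor of the characteristic polynomial and [N] the entries of the adjugate. *)
exists (q * N); first by rewrite mulf_neq0.
move=> K u u0; pose S j := \sum_(j <= t < K) A ^+ (t - j) *m intv (u t).
have SE j : (j < K)%N -> S j = intv (u j) + A *m S j.+1.
  move=> jK; rewrite /S big_ltn // subnn expr0 mul1mx; congr (_ + _).
  rewrite mulmx_sumr; apply: eq_big_nat => t /andP[jt _].
  by rewrite mulmxA -subnSK // exprS.
have S0 : S 0%N = 0.
  by rewrite -[RHS]u0; apply: eq_bigr => t _; rewrite subn0.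
have Sge j : (K <= j)%N -> S j = 0 by move=> Kj; rewrite /S big_geq.
pose U : 'cV[{poly rat}]_n.+1 := \col_i \poly_(t < K) (intv (u t)) i 0.
pose g : 'cV[{poly rat}]_n.+1 := \col_i \poly_(t < K) (S t.+1) i 0.
(* Coefficientwise this is the Horner recursion [SE]; the constant term uses [S 0 = 0]. *)
have CgU : C *m g = U.
  rewrite /C /char_poly_mx mulmxBl mul_scalar_mx.
  apply/matrixP => i j; rewrite ord1 {j} !mxE; apply/polyP => t.
  rewrite coefB coefXM !coef_poly.
  have -> : (\sum_k map_mx polyC A i k * g k 0)`_t =
      if (t < K)%N then (A *m S t.+1) i 0 else 0.
    rewrite coef_sum; case: ifP => tK; last first.
      by rewrite big1 // => k _; rewrite !mxE coefCM coef_poly tK mulr0.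
    by rewrite mxE; apply: eq_bigr => k _; rewrite !mxE coefCM coef_poly tK.
  case: t => [|t] /=.
    case: ifP => K0; rewrite ?subr0 // sub0r; have := SE 0%N K0.
    by rewrite S0 => /matrixP/(_ i 0); rewrite !mxE => H; lra.
  case: (ltnP t.+1 K) => tK.
    by rewrite (ltnW tK) (SE _ tK) mxE addrK.
  by rewrite subr0 (Sge _ tK) mxE if_same.
have chig i : char_poly A * g i 0 = (\adj C *m U) i 0.
  by rewrite -CgU mulmxA mul_adj_mx mul_scalar_mx [RHS]mxE.
move=> j jK; case: j jK => [|j] jK; first by exists 0;
  rewrite -/(S 0%N) S0 scaler0 raddf0.
have gint i : exists w : int, (q * N)%:~R * S j.+1 i 0 = w%:~R.
  have /choice[p pP] := NP.
  have [|r rE] := qP (N%:~R *: g i 0) (\sum_k p (i,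
    k) * (\poly_(t < K) u t k 0)).
    rewrite -scalerAr chig mxE scaler_sumr rmorph_sum; apply: eq_bigr => k _.
    rewrite rmorphM /= -pP scalerAl [U k 0]mxE; congr (_ * _).
    apply/polyP => t; rewrite coef_map /= !coef_poly.
    by case: ifP; rewrite ?mxE.
  exists r`_j; rewrite -coef_map -rE !coefZ intrM -mulrA; do 2 congr (_ * _).
  by rewrite mxE coef_poly (ltnW jK).
have /choice[w wP] := gint; exists (\col_i w i).
by apply/matrixP => i k; rewrite ord1 !mxE wP.
Qed.

End common_denominator.

(** * Finiteness of bounded parts of Z^n[A] within B^-m Z^n[B] *)

Section integrality.
Context {n : nat}.
Local Notation intv := (map_mx (intr : int -> rat)).
Implicit Type A : 'M[rat]_n.+1.

Lemma Zpoly_sum A x : Zpoly A x -> exists (k : nat) (z : nat -> 'cV[int]_n.+1),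
  forall K, (k <= K)%N -> x = \sum_(0 <= t < K) A ^+ t *m intv (z t).
Proof.
move=> [k [z ->]]; exists k.+1, (fun t =>
  if (t < k.+1)%N then z t else 0) => K kK.
rewrite (@big_cat_nat _ _ _ k.+1) //= [X in _ = _ + X]big_nat [X in _ = _ +
  X]big1 ?addr0.
  by rewrite big_mkord; apply: eq_bigr => i _; rewrite ltn_ord.
by move=> i /andP[ki _]; rewrite ltnNge ki raddf0 mulmx0.
Qed.

(** Comparing the two expansions of [x] gives a relation u(A) = 0. One of its Horner partial sums is
    [x] minus an integral combination of 1, A, ..., A^m; the sum has denominator [q] and the powers
    have common denominator [N]. *)
Lemma Zpoly_cap_denominator A (m : nat) : A \is a GRing.unit ->
  exists2 q : int, q != 0 & forall x,
    Zpoly A x -> Zfilt A^-1 (- m%:Z) x ->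
      exists w : 'cV[int]_n.+1, q%:~R *: x = intv w.
Proof.
move=> uA; have [q q0 qP] := horner_quotient_denominator A.
have [N N0 NP] := matrix_common_denominator (fun i : 'I_m.+1 => A ^+ i).
exists (q * N); first by rewrite mulf_neq0.
move=> x Ax [y By yx].
have xE : x = A ^+ m *m y by rewrite -yx exprz_inv opprK.
have AD i j : A ^+ i *m A ^+ j = A ^+ (i + j) by rewrite exprD.
have [k1 [z zP]] := Zpoly_sum Ax; have [k [w wP]] := Zpoly_sum By.
pose K := (k1 + k + m).+1.
(* Coefficients of the difference of two expansions of [A^k x]: [z] is shifted up by [k], and [w] is
   reversed because its powers of [A] descend from [m + k]. *)
pose u t := (if (t < k)%N then 0 else z (t - k)%N) -
  (if (t <= m + k)%N then w (m + k - t)%N else 0).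
have uE t : intv (u t) = intv (if (t < k)%N then 0 else z (t - k)%N) -
  intv (if (t <= m + k)%N then w (m + k - t)%N else 0) by rewrite /u raddfB.
have u0 : \sum_(0 <= t < K + k) A ^+ t *m intv (u t) = 0.
  under eq_bigr do rewrite uE mulmxBr.
  rewrite sumrB; apply/eqP; rewrite subr_eq0; apply/eqP.
  transitivity (A ^+ k *m x).
    rewrite (@big_cat_nat _ _ _ k) ?leq_addl //= big_nat big1 ?add0r;
      last first.
      by move=> t /= tk; rewrite tk raddf0 mulmx0.
    rewrite -{1}[k]add0n big_addn addnK (zP K); last by rewrite /K; lia.
    rewrite mulmx_sumr; apply: eq_bigr => t _.
    by rewrite ltnNge leq_addl /= addnK mulmxA AD addnC.
  have mkK : (m + k < K + k)%N by rewrite /K; lia.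
  rewrite [RHS](@big_cat_nat _ _ _ (m + k).+1) //= [X in _ = _ + X]big_nat.
  rewrite [X in _ = _ + X]big1 ?addr0; last first.
    by move=> t /andP[mt _]; rewrite leqNgt mt /= raddf0 mulmx0.
  rewrite big_nat_rev /= add0n xE (wP (m + k).+1); last by lia.
  rewrite !mulmxA AD mulmx_sumr; apply: eq_big_nat => t;
    rewrite ltnS => /andP[_ tmk].
  rewrite subSS leq_subr subKn // mulmxA; congr (_ *m _).
  have VD : A ^+ t *m A^-1 ^+ t = 1%:M.
    by rewrite exprVn; apply: mulrV; rewrite unitrX.
  by rewrite [(k + m)%N]addnC -[in LHS](subnK tmk) -AD -mulmxA VD mulmx1.
have kK : (k < K + k)%N by rewrite /K; lia.
have [v vE] := qP _ _ u0 k kK.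
(* Dropping the terms below index [k] and dividing by [A^k] leaves all of the first expansion and
   the part of the second with nonnegative powers of [A]. *)
have SE : \sum_(k <= t < K + k) A ^+ (t - k) *m intv (u t) =
    x - \sum_(i < m.+1) A ^+ i *m intv (w (m - i)%N).
  rewrite -{1}[k]add0n big_addn addnK.
  under eq_bigr do rewrite addnK uE mulmxBr ltnNge leq_addl /= addnK.
  rewrite sumrB -(zP K); last by rewrite /K; lia.
  congr (_ - _); rewrite (@big_cat_nat _ _ _ m.+1) //=; last by rewrite /K; lia.
  rewrite big_mkord [X in _ + X]big_nat [X in _ + X]big1 ?addr0.
    by apply: eq_bigr => i _; rewrite leq_add2r -ltnS ltn_ord subnDr.
  by move=> t /andP[mt _]; rewrite leq_add2r leqNgt mt /= raddf0 mulmx0.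
have /choice[c cP] := NP.
exists (N *: v + q *: \sum_(i < m.+1) c i *m w (m - i)%N).
have intvZ (a : int) (s : 'cV[int]_n.+1) : intv (a *: s) = a%:~R *: intv s.
  by apply/matrixP => i j; rewrite !mxE intrM.
have cE : intv (\sum_(i < m.+1) c i *m w (m - i)%N) =
    N%:~R *: \sum_(i < m.+1) A ^+ i *m intv (w (m - i)%N).
  rewrite raddf_sum scaler_sumr; apply: eq_bigr => i _.
  by rewrite /= map_mxM /= -cP scalemxAl.
rewrite raddfD /= !intvZ -vE SE cE intrM scalerBr scalerBr !scalerA.
by rewrite [N%:~R * _]mulrC subrK.
Qed.

Lemma finite_bounded_int_vectors (r : int) :
  finite_set [set w : 'cV[int]_n.+1 | forall i, `|w i 0| <= r].
Proof.
pose N := (`|r|%N.*2).+1.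
apply: (@sub_finite_set _ _
  ((fun f : {ffun 'I_n.+1 -> 'I_N} => \col_i ((f i)%:Z - `|r|%N%:Z)) @` setT)).
  move=> w /= wr; have wN i : (absz (w i 0 + `|r|%N%:Z)%R < N)%N by rewrite /N;
    move: (w i 0) (wr i) => a; rewrite ler_norml => /andP[]; lia.
  exists [ffun i => Ordinal (wN i)] => //; apply/matrixP => i j.
  rewrite ord1 !mxE ffunE /=; move: (w i 0) (wr i) => a.
  by rewrite ler_norml => /andP[]; lia.
exact/finite_image/finite_finset.
Qed.

(** With a common denominator [q], such vectors are bounded elements of (1/q) Z^n. *)
Lemma finite_Zpoly_cap A (m : nat) (r : rat) : A \is a GRing.unit ->
  finite_set [set x | [/\ Zpoly A x, Zfilt A^-1 (- m%:Z) x &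
    forall i, `|x i 0| <= r]].
Proof.
move=> uA; have [q q0 qP] := Zpoly_cap_denominator m uA.
have [N NP] : exists N : int, `|q%:~R| * r <= N%:~R.
  exists (Num.ceil (`|q%:~R| * r)); exact: Num.Theory.ceil_ge.
apply: (@sub_finite_set _ _
  [set q%:~R^-1 *: intv w | w in [set w : 'cV[int]_n.+1 | forall i,
    `|w i 0| <= N]]).
  move=> x [Ax Bx xr]; have [w wE] := qP x Ax Bx.
  exists w; last by rewrite -wE scalerA mulVf ?scale1r // intr_eq0.
  move=> i; have := xr i; rewrite -(ler_int rat) intr_norm.
  have -> : (w i 0)%:~R = q%:~R * x i 0 :> rat.
    by have /matrixP/(_ i 0) := wE; rewrite !mxE.
  by move=> xir; rewrite normrM (le_trans _ NP) // ler_wpM2l.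
exact/finite_image/finite_bounded_int_vectors.
Qed.

End integrality.

(** * Powers of an expanding matrix *)

Lemma contracting_recurrence_cvg0 (R : realType) (r : R) (a e : nat -> R) :
  0 <= r < 1 -> (forall k, 0 <= a k) -> (forall k, a k.+1 <= r * a k + e k) ->
  (forall d : R, 0 < d -> exists K, forall k, (K <= k)%N -> e k < d) ->
  forall d : R, 0 < d -> exists K, forall k, (K <= k)%N -> a k < d.
Proof.
move=> /andP[r0 r1] a0 aS ecvg d d0.
(* With this bound on [e], the limiting recursion [t |-> r * t + d / 2 * (1 - r)] has fixed point
   [d / 2]. *)
have d'0 : 0 < d / 2 * (1 - r) by rewrite !mulr_gt0 ?invr_gt0 // subr_gt0.
have [K HK] := ecvg _ d'0.
have aK j : a (K + j)%N <= r ^+ j * a K + d / 2.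
  elim: j => [|j IH]; first by rewrite addn0 expr0 mul1r lerDl ltW // divr_gt0.
  rewrite addnS; apply: le_trans (aS _) _.
  have := HK (K + j)%N (leq_addr _ _); have := ler_wpM2l r0 IH.
  by rewrite exprS mulrDr mulrA; lra.
have : `|r| < 1 by rewrite ger0_norm.
have c0 : 0 < d / 2 / (a K + 1).
  by rewrite !divr_gt0 // ltr_wpDl.
move=> /cvg_expr/cvgrPdist_lt/(_ _ c0)[J _ HJ]; exists (K + J)%N => k Kk.
have -> : k = (K + (k - K))%N by lia.
have /HJ : (J <= k - K)%N by lia.
rewrite /= sub0r normrN ger0_norm ?exprn_ge0 // ltr_pdivlMr ?ltr_wpDl // => rJ.
have := aK (k - K)%N; have : 0 <= r ^+ (k - K) by rewrite exprn_ge0.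
by lra.
Qed.

Section complex_powers.
Import ComplexField.Normc.
Context {R : realType}.
Local Notation C := R[i].

Let normc_ge0 (x : C) : 0 <= normc x.
Proof. by case: x => a b; exact: sqrtr_ge0. Qed.

(* Peel off one factor at a time: [W' := (M - z) W] satisfies
   [M ^ k.+1 W = z M ^ k W + M ^ k W']. *)
Lemma powers_mul_cvg0 (n : nat) (M : 'M[C]_n.+1) (s : seq C) :
  (forall z, z \in s -> normc z < 1) ->
  forall W : 'M[C]_n.+1, horner_mx M (\prod_(z <- s) ('X - z%:P)) * W = 0 ->
  forall i j (d : R), 0 < d ->
    exists K, forall k, (K <= k)%N -> normc ((M ^+ k * W) i j) < d.
Proof.
elim: s => [|z s IH] s1 W.
  rewrite big_nil rmorph1 mul1r => -> i j d d0; exists 0%N => k _.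
  by rewrite mulr0 mxE normc0.
rewrite big_cons mulrC rmorphM /= -mulrA => sW i j.
have zs k : normc ((M ^+ k.+1 * W) i j) <= normc z * normc ((M ^+ k * W) i j) +
    normc ((M ^+ k * (horner_mx M ('X - z%:P) * W)) i j).
  have -> : M ^+ k.+1 * W =
      z *: (M ^+ k * W) + M ^+ k * (horner_mx M ('X - z%:P) * W).
    rewrite rmorphB /= horner_mx_X horner_mx_C mulrBl mulrBr mulrA -exprSr.
    rewrite (_ : z%:M * W = z *: W); last exact: mul_scalar_mx.
    by rewrite -scalerAr addrC subrK.
  by rewrite -normcM mxE [X in X + _]mxE; exact: le_normcD.
apply: contracting_recurrence_cvg0 zs _ => //.
- by rewrite normc_ge0 s1 // mem_head.
- by move=> d d0; apply: IH d0 => // y ys; apply: s1; rewrite inE ys orbT.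
Qed.

End complex_powers.

Section expanding_powers.
Import ComplexField.Normc.
Context {R : realType} {n : nat} (A : 'M[rat]_n.+1).
Hypothesis hA : expanding R A.

Let uA : A \is a GRing.unit. Proof. exact: expanding_unit hA. Qed.

Lemma eigenvalue_inv_lt1 (z : R[i]) :
  eigenvalue (map_mx ratr A^-1 : 'M[R[i]]_n.+1) z -> normc z < 1.
Proof.
move=> /eigenvalueP[v vz v0].
have BA : map_mx ratr A^-1 *m map_mx ratr A = 1%:M :> 'M[R[i]]_n.+1.
  rewrite -map_mxM -(map_mx1 ratr); congr map_mx; exact: mulVr.
have zv : v = z *: (v *m map_mx ratr A).
  by rewrite -[LHS]mulmx1 -BA mulmxA vz scalemxAl.
have z0 : z != 0 by apply: contraNneq v0 => z0; rewrite zv z0 scale0r.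
have : eigenvalue (map_mx ratr A : 'M[R[i]]_n.+1) z^-1.
  apply/eigenvalueP; exists v => //.
  by rewrite [in RHS]zv scalerA mulVf // scale1r.
move/hA; rewrite normrV ?unitfE // invr_gt1 ?unitfE ?normr_eq0 ?normr_gt0 //.
have -> : `|z| = (normc z)%:C%C by [].
by rewrite -[X in _ < X]/(1%:C%C) ltcR.
Qed.

(** Over [R[i]] the characteristic polynomial of [A^-1] splits with all roots of modulus below 1,
    and it annihilates the matrix by Cayley-Hamilton; so [powers_mul_cvg0] applies with [W = 1]. *)
Lemma expanding_inv_powers (d : R) : 0 < d -> exists K, forall k, (K <= k)%N ->
  forall i j, `|ratr ((A^-1 ^+ k) i j)| < d.
Proof.
move=> d0; pose M : 'M[R[i]]_n.+1 := map_mx ratr A^-1.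
have [s sE] := closed_field_poly_normal (char_poly M).
rewrite (monicP (char_poly_monic M)) scale1r in sE.
have s1 z : z \in s -> normc z < 1.
  move=> zs; apply: eigenvalue_inv_lt1; rewrite eigenvalue_root_char sE.
  by rewrite root_prod_XsubC.
have sM : horner_mx M (\prod_(z <- s) ('X - z%:P)) * 1 = 0.
  by rewrite mulr1 -sE; exact: Cayley_Hamilton.
have nE (q : rat) : normc (ratr q : R[i]) = `|ratr q : R|.
  rewrite -(fmorph_rat (real_complex R)) /= /normc /=.
  by rewrite expr0n addr0 sqrtr_sqr.
have /choice[K KP] ij : exists K, forall k, (K <= k)%N ->
    normc ((M ^+ k) ij.1 ij.2) < d.
  have [K HK] := powers_mul_cvg0 s1 sM ij.1 ij.2 d0.
  by exists K => k /HK; rewrite mulr1.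
exists (\max_ij K ij) => k Kk i j; rewrite -nE.
have : normc ((M ^+ k) i j) < d.
  by apply: (KP (i, j)); rewrite (leq_trans _ Kk) // leq_bigmax.
by rewrite /M -rmorphXn /= mxE.
Qed.

End expanding_powers.

(** * The metric group K_A *)

Section column_norm.
Context {R : realType} {n : nat}.
Implicit Type x : 'cV[R]_n.+1.

Lemma le_colnormP x (c : R) : 0 <= c ->
  reflect (forall i, `|x i 0| <= c) (`|x| <= c).
Proof.
move=> c0; have -> : `|x| = mx_norm x by [].
rewrite mx_normrE; apply: (iffP (bigmax_leP _ _ _ _)) => [[_ H] i|H].
  exact: (H (i, 0)).
by split=> // -[i j] _; rewrite ord1.
Qed.

Lemma entry_le_colnorm x i : `|x i 0| <= `|x|.
Proof. by apply/le_colnormP: i. Qed.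

Lemma colnorm_mulmx_le (M : 'M[R]_n.+1) x (c : R) : 0 <= c ->
  (forall i j, `|M i j| <= c) -> `|M *m x| <= n.+1%:R * c * `|x|.
Proof.
move=> c0 Mc; apply/le_colnormP => [|i]; first by rewrite !mulr_ge0.
rewrite mxE (le_trans (ler_norm_sum _ _ _)) //.
apply: (@le_trans _ _ (\sum_(j < n.+1) c * `|x|)).
  apply: ler_sum => j _; rewrite normrM ler_pM //; exact: entry_le_colnorm.
by rewrite sumr_const card_ord -[leLHS]mulr_natl mulrA.
Qed.

Lemma matrix_entries_bounded (M : 'M[R]_n.+1) :
  exists2 c : R, 0 <= c & forall i j, `|M i j| <= c.
Proof.
exists (\sum_i \sum_j `|M i j|); first by do 2 apply: sumr_ge0 => ? _.
move=> i j; rewrite (bigD1 i) //= (bigD1 j) //= -addrA lerDl addr_ge0 ?sumr_ge0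
  //.
by move=> k _; apply: sumr_ge0.
Qed.

Lemma colnorm_ball_totally_bounded (r e : R) : 0 < e ->
  exists s : seq 'cV[R]_n.+1, forall x, `|x| < r ->
    exists2 p, p \in s & `|x - p| < e.
Proof.
move=> e0; pose h := e / 2; have h0 : 0 < h by rewrite divr_gt0.
(* Enough grid points of mesh [h], starting at [- r], to reach every coordinate in [[- r, r]]. *)
pose N := (Num.truncn (2 * r / h)).+1.
pose grid (f : {ffun 'I_n.+1 ->
  'I_N}) : 'cV[R]_n.+1 := \col_i ((f i)%:R * h - r).
exists (map grid (enum {: {ffun 'I_n.+1 -> 'I_N}})) => x xr.
have xir i : `|x i 0| < r by rewrite (le_lt_trans (entry_le_colnorm _ _)).
have yN i : (Num.truncn ((x i 0 + r) / h)%R < N)%N.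
  rewrite ltnS; apply: le_truncn; rewrite ler_pM2r ?invr_gt0 //.
  by have := xir i; rewrite ltr_norml; lra.
exists (grid [ffun i => Ordinal (yN i)]); first by rewrite map_f // mem_enum.
apply: (@le_lt_trans _ _ h); last by rewrite /h; lra.
apply/le_colnormP => [|i]; first exact: ltW.
rewrite !mxE ffunE /=; have y0 : 0 <= (x i 0 + r) / h.
  by rewrite divr_ge0 ?ltW //; have := xir i; rewrite ltr_norml; lra.
have /andP[] := truncn_itv y0; rewrite ler_pdivlMr // ltr_pdivrMr // -natr1.
by rewrite ler_norml; lra.
Qed.

End column_norm.

Section KA_norm.
Context {R : realType} {n : nat} {A : 'M[rat]_n.+1}.
Context {hA : expanding R A} {hb : (1 < Zindex A^-1)%N}.
Local Notation b := ((Zindex A^-1)%:R : R).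
Local Notation K := (KA hA hb).
Local Notation mulA := (@KAmulA R n A hA hb).
Local Notation ZBg := (Defs_ZB__canonical__Algebra_Zmodule hA hb).

Let uA : A \is a GRing.unit. Proof. exact: expanding_unit hA. Qed.
Let b_gt1 : 1 < b. Proof. by rewrite ltr1n. Qed.
Let b_gt0 : 0 < b. Proof. exact: lt_trans b_gt1. Qed.

(** On the real factor this is the sup norm; by [ball_KAnorm] its balls are those of the product
    structure on K_A. *)
Definition KAnorm (p : K) : R := Num.max `|p.1| (Zdist p.2 0).

Lemma ball_KAnorm (p : K) (e : R) : ball p e = [set q | KAnorm (q - p) < e].
Proof.
apply/seteqP; split=> q; rewrite /KAnorm /= gt_max Zdist_sub0.
  move=> [q1 q2]; rewrite mx_norm_ball in q1.
  by rewrite distrC q1 ZdistC; rewrite ballEmdist in q2.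
move=> /andP[q1 q2]; split; first by rewrite mx_norm_ball /ball_ /= distrC.
by rewrite ballEmdist /= -[mdist _ _]/(Zdist p.2 q.2) ZdistC.
Qed.

Lemma KAnorm_group_norm : group_norm KAnorm.
Proof.
split.
- by rewrite /KAnorm normr0 Zdistxx maxxx.
- move=> p; rewrite /KAnorm normrN; congr Num.max.
  by rewrite /= -sub0r Zdist_sub0 ZdistC.
- move=> p q; rewrite /KAnorm ge_max; apply/andP; split.
    apply: le_trans (ler_normD _ _) _.
    by rewrite lerD // le_max lexx.
  apply: le_trans (Zdist_tri q.2 _ _) _; rewrite /= -(Zdist_sub0 (_ + _)) addrK.
  by rewrite lerD // le_max lexx orbT.
- move=> p U; split=> [/nbhs_ballP[e /= e0 eU]|[e e0 eU]].
    by exists e => // q pq; apply: eU; rewrite ball_KAnorm.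
  by apply/nbhs_ballP; exists e => // q; rewrite ball_KAnorm; exact: eU.
Qed.

Lemma KAnorm_eq0 (p : K) : KAnorm p = 0 -> p = 0.
Proof.
move=> p0; have : KAnorm p <= 0 by rewrite p0.
rewrite /KAnorm ge_max normr_le0 => /andP[/eqP p1 p2].
rewrite [p]surjective_pairing p1; congr pair;
  apply: (@mdist_positivity _ (Zcompl hA hb)).
by apply/le_anti; rewrite mdist_ge0 andbT.
Qed.

Lemma KA_hausdorff : hausdorff_space K.
Proof. exact: group_norm_hausdorff KAnorm_group_norm KAnorm_eq0. Qed.

Lemma KAmulAB (p q : K) : KAmulA (p - q) = KAmulA p - KAmulA q.
Proof. by rewrite /KAmulA /= mulmxBr ZmulAB. Qed.

Let ZmulA0 : ZmulA (0 : Zcompl hA hb) = 0.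
Proof. by have := ZmulAB (0 : Zcompl hA hb) 0; rewrite !subrr. Qed.

Lemma KAmulA_lipschitz : exists C, forall p : K, KAnorm (KAmulA p) <=
  C * KAnorm p.
Proof.
have [c c0 cP] := matrix_entries_bounded (map_mx ratr A : 'M[R]_n.+1).
exists (Num.max (n.+1%:R * c) b) => p; rewrite {1}/KAnorm ge_max; apply/andP;
  split.
  apply: le_trans (colnorm_mulmx_le _ c0 cP) _.
  by rewrite ler_pM ?mulr_ge0 // le_max lexx.
rewrite -ZmulA0 Zdist_ZmulA ler_pM ?(ltW b_gt0) ?le_max ?lexx ?orbT //.
exact: (@mdist_ge0 _ (Zcompl hA hb)).
Qed.

Let iter_KAmulA k (p : K) :
  (iter k mulA p).1 = (map_mx ratr (A ^+ k)) *m p.1 /\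
  Zdist (iter k mulA p).2 0 = b ^+ k * Zdist p.2 0.
Proof.
elim: k => [|k [IH1 IH2]] /=.
  by rewrite !expr0 mul1r map_mx1 mul1mx.
by rewrite IH1 mulmxA -map_mxM -ZmulA0 Zdist_ZmulA IH2 mulrA -exprS ZmulA0
  exprS.
Qed.

Lemma KAmulA_expanding (r e : R) : 0 < e ->
  exists k, forall p : K, KAnorm (iter k mulA p) < r -> KAnorm p < e.
Proof.
move=> e0; pose r' := Num.max r 1.
have r'0 : 0 < r' by rewrite lt_max ltr01 orbT.
(* Chosen so that the operator bound [n.+1%:R * d] times [r'] equals [e / 2]. *)
pose d := e / (2 * r') / n.+1%:R.
have d0 : 0 < d by rewrite !divr_gt0 // mulr_gt0.
have [k1 k1P] := expanding_inv_powers hA d0.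
have [k2 k2P] := expVn_small (A := A) (hb := hb) (divr_gt0 e0 r'0).
pose k := maxn k1 k2; exists k => p pk.
have {}pk : KAnorm (iter k mulA p) < r' by rewrite lt_max pk.
have [p1 p2] := iter_KAmulA k p; move: pk; rewrite /KAnorm !gt_max p1 p2.
move=> /andP[n1 n2]; apply/andP; split.
  have -> : p.1 = map_mx ratr (A^-1 ^+ k) *m (map_mx ratr (A ^+ k) *m p.1).
    rewrite mulmxA -map_mxM.
    have -> : A^-1 ^+ k *m A ^+ k = 1%:M by rewrite exprVn; apply: mulVr;
      rewrite unitrX.
    by rewrite map_mx1 mul1mx.
  apply: (@le_lt_trans _ _ (n.+1%:R * d * r')).
    apply: (le_trans (colnorm_mulmx_le _ (ltW d0) _)).
      by move=> i j; rewrite mxE ltW // k1P // leq_maxl.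
    by apply: ler_wpM2l; [rewrite mulr_ge0 // ltW|exact: ltW].
  have -> : n.+1%:R * d * r' = e / 2.
    rewrite /d mulrC [n.+1%:R * _]mulrC divfK ?pnatr_eq0 // invfM !mulrA.
    by rewrite [r' * e]mulrC mulrAC mulfK // gt_eqF.
  by lra.
have bk : b ^- k <= b ^- k2.
  by rewrite lef_pV2 ?posrE ?exprn_gt0 // ler_eXn2l // leq_maxr.
rewrite -(ltr_pM2l (exprn_gt0 k b_gt0)); apply: (lt_le_trans n2).
have := le_lt_trans bk k2P; rewrite ltr_pdivlMr // => /ltW.
by rewrite -(ler_pM2l (exprn_gt0 k b_gt0)) mulrA mulfV ?mul1r // expf_neq0 //
  gt_eqF.
Qed.

(** On Z^n((B)), surjectivity is [ZmulA_surj], and injectivity follows from the exact scaling of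
    distances by [b > 0]. *)
Lemma KAmulA_bij : exists B : K -> K, cancel mulA B /\ cancel B mulA.
Proof.
have /choice[zB zBK] := @ZmulA_surj R n A hA hb.
have zAK : cancel (@ZmulA R n A hA hb) zB.
  move=> y; apply: (@mdist_positivity _ (Zcompl hA hb)).
  have := Zdist_ZmulA (zB (ZmulA y)) y.
  by rewrite zBK Zdistxx => /esym/eqP; rewrite mulf_eq0 gt_eqF // => /eqP.
have BA : map_mx ratr A^-1 *m map_mx ratr A = 1%:M :> 'M[R]_n.+1.
  by rewrite -map_mxM -(map_mx1 ratr); congr map_mx; exact: mulVr.
exists (fun p : K => (map_mx ratr A^-1 *m p.1, zB p.2)); split=> -[x y].
  by rewrite /KAmulA /= mulmxA BA mul1mx zAK.
by rewrite /KAmulA /= mulmxA (mulmx1C BA) mul1mx zBK.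
Qed.

Lemma KA_totally_bounded (e : R) : 0 < e -> exists s : seq K,
  nball KAnorm 0 3 `<=` [set q | exists2 p, p \in s & nball KAnorm p e q].
Proof.
move=> e0; have [s sP] := @colnorm_ball_totally_bounded R n 3 e e0.
have [t tP] := @Zball_totally_bounded R n A hA hb 3 e e0.
exists [seq (x, y) | x <- s, y <- t] => q.
rewrite /nball /= subr0 /KAnorm gt_max => /andP[/sP[x xs xq] /tP[y yt yq]].
exists (x, y); first by apply/allpairsP; exists (x, y).
by rewrite /= gt_max xq Zdist_sub0.
Qed.

End KA_norm.

(** * Measures on K_A *)

Section borel_sets.
Context {T : ptopologicalType}.

Lemma borel_open (U : set T) : open U -> measurable (U : set (borel T)).
Proof. by move=> oU; exact: sub_sigma_algebra. Qed.

Lemma borel_closed (U : set T) : closed U -> measurable (U : set (borel T)).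
Proof.
move=> clU; rewrite -[U]setCK; apply: measurableC.
by apply: borel_open; exact: closed_openC.
Qed.

End borel_sets.

(** * Translation invariance of Lebesgue measure from the volumes of boxes *)

Section lebesgue.
Context {R : realType} {n : nat}.
Local Notation V := 'cV[R]_n.+1.
Implicit Types (a b c x : V).

Definition box a b : set V := [set x | forall i, a i 0 <= x i 0 <= b i 0].

Lemma ball_colnorm x (e : R) : ball x e = [set y | `|y - x| < e].
Proof.
by rewrite mx_norm_ball; apply/funext => y; rewrite /ball_ /= distrC.
Qed.

Lemma colnorm_group_norm : group_norm (fun x : V => `|x|).
Proof.
split; [exact: normr0|exact: normrN|exact: ler_normD|] => p U.
split=> [/nbhs_ballP[e /= e0 eU]|[e e0 eU]].
  by exists e => // q pq; apply: eU; rewrite ball_colnorm.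
by apply/nbhs_ballP; exists e => // q; rewrite ball_colnorm; exact: eU.
Qed.

Lemma closed_box a b : closed (box a b).
Proof.
rewrite -[box a b]setCK; apply: open_closedC; rewrite openE => x /= nx.
have [k nk] : exists k, ~ (a k 0 <= x k 0 <= b k 0) by apply/existsNP.
apply/(nbhs_normP colnorm_group_norm).
have near y : `|y - x| < Num.max (a k 0 - x k 0) (x k 0 - b k 0) -> ~ box a b y.
  move=> yx yab; have := le_lt_trans (entry_le_colnorm (y - x) k) yx.
  by have := yab k; rewrite !mxE lt_max !ltr_norml; lra.
exists (Num.max (a k 0 - x k 0) (x k 0 - b k 0)); last exact: near.
by rewrite lt_max !subr_gt0; move/negP: nk; rewrite negb_and -!ltNge.
Qed.

Lemma boxI a b c d : box a b `&` box c d =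
  box (\col_i Num.max (a i 0) (c i 0)) (\col_i Num.min (b i 0) (d i 0)).
Proof.
apply/seteqP; split=> x /=; rewrite /box /=.
  move=> [xab xcd] i; have /andP[a1 a2] := xab i; have /andP[c1 c2] := xcd i.
  by rewrite !mxE ge_max le_min a1 a2 c1 c2.
by move=> H; split=> i; have := H i;
  rewrite !mxE ge_max le_min => /andP[/andP[? ?] /andP[? ?]]; apply/andP.
Qed.

Lemma box_eq0 a b : ~ (forall i, a i 0 <= b i 0) -> box a b = set0.
Proof.
move=> nab; rewrite -subset0 => x xab; apply: nab => i.
by have /andP[] := xab i; exact: le_trans.
Qed.

(** The boxes have rational corners, so the union is countable; hence boxes generate the Borel
    sets. *)
Lemma open_bigcup_box (U : set V) : open U ->
  U = \bigcup_(q in [set q : 'cV[rat]_n.+1 * 'cV[rat]_n.+1 |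
    box (map_mx ratr q.1) (map_mx ratr q.2) `<=`
      U]) box (map_mx ratr q.1) (map_mx ratr q.2).
Proof.
move=> oU; apply/seteqP; split=> [x Ux|x [q qU]]; last exact: qU.
have [e e0 eU] : exists2 e : R, 0 < e & nball (fun x : V => `|x|) x e `<=` U.
  by apply/(nbhs_normP colnorm_group_norm); exact: open_nbhs_nbhs.
have e2 : 0 < e / 2 by rewrite divr_gt0.
have /choice[q qP] i : exists q : rat, x i 0 - e / 2 < ratr q < x i 0.
  have [|q] := @rat_in_itvoo R (x i 0 - e / 2) (x i 0); first by lra.
  by rewrite in_itv /=; exists q.
have /choice[r rP] i : exists r : rat, x i 0 < ratr r < x i 0 + e / 2.
  have [|r] := @rat_in_itvoo R (x i 0) (x i 0 + e / 2); first by lra.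
  by rewrite in_itv /=; exists r.
exists (\col_i q i, \col_i r i); last first.
  by move=> i; rewrite !mxE; have := qP i; have := rP i; lra.
move=> y yb; apply: eU; rewrite /nball /= (@le_lt_trans _ _ (e / 2)) //;
  last by lra.
apply/le_colnormP => [|i]; first exact: ltW.
have := yb i; rewrite !mxE; have := qP i; have := rP i.
by rewrite ler_norml; lra.
Qed.

Lemma borel_box : (measurable : set (set (borel V))) = <<s [set E | exists a b,
  E = box a b] >>.
Proof.
apply/seteqP; split.
  apply: smallest_sub; first exact: smallest_sigma_algebra.
  move=> U /open_bigcup_box ->; rewrite bigcup_mkcond.
  pose T := g_sigma_algebraType [set E | exists a b, E = box a b].
  apply: (@countable_bigcupT_measurable _ T) => // q.
  by case: ifP => _ //; apply: sub_sigma_algebra; eexists; eexists.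
apply: smallest_sub; first exact: sigma_algebra_measurable.
by move=> _ [a [b ->]]; apply: (@borel_closed V); exact: closed_box.
Qed.

Context (lam : {measure set (borel V) -> \bar R}).
Hypothesis hlam : is_lebesgue lam.

Lemma lebesgue_box_fin a b : (lam (box a b) < +oo)%E.
Proof.
have [ab|nab] := pselect (forall i, a i 0 <= b i 0).
  by rewrite hlam // ltry.
by rewrite box_eq0 // measure0.
Qed.

Lemma measurable_translation c :
  measurable_fun setT (fun x : borel V => (x : V) + c : borel V).
Proof.
apply: (@measurability _ _ (borel V) (borel V) setT _ (@open V)) =>
  // _ [U oU <-].
rewrite setTI; apply: (@borel_open V); rewrite openE => x /= Uxc.
have /(nbhs_normP colnorm_group_norm)[e e0 eU] : nbhs ((x : V) + c) (U : set V).
  exact: open_nbhs_nbhs.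
apply/(nbhs_normP colnorm_group_norm); exists e => // y yx; apply: eU.
by rewrite /nball /= opprD addrACA subrr addr0.
Qed.

(** The pushforward under a translation agrees with [lam] on boxes, which are stable under
    intersection, generate the Borel sets and include the exhausting cubes [g k] of finite measure.
    Uniqueness of measures concludes. *)
Lemma lebesgue_translation c (E : set (borel V)) : measurable E ->
  lam [set x | E (x + c)] = lam E.
Proof.
move=> mE; pose G : set (set (borel V)) := [set E | exists a b, E = box a b].
pose m := measure_function_pushforward__canonical__measure_function_Measure
  lam (measurable_translation c).
pose g k : set (borel V) := box (const_mx (- k%:R)) (const_mx k%:R).
apply/esym; apply: (@measure_unique _ R _ G g borel_box _ _ _ lam m _ _ E mE).
- by move=> _ _ [a [b ->]] [a' [b' ->]]; rewrite boxI; do 2 eexists.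
- by move=> k; do 2 eexists.
- apply/seteqP; split=> // x _; exists (Num.truncn `|x : V|).+1 => // i.
  rewrite !mxE -ler_norml (le_trans (entry_le_colnorm _ _)) // ltW //.
  by have /andP[] := truncn_itv (normr_ge0 (x : V)).
- move=> _ [a [b ->]]; rewrite /= /pushforward.
  have -> : (fun x : borel V =>
    (x : V) + c : borel V) @^-1` box a b = box (a - c) (b - c).
    by apply/seteqP; split=> x xab i; have := xab i;
      rewrite !mxE lerBlDr lerBrDr.
  have [ab|nab] := pselect (forall i, a i 0 <= b i 0).
    rewrite !hlam //; last by move=> i; rewrite !mxE lerD2r.
    by congr EFin; apply: eq_bigr => i _; rewrite !mxE opprB addrA subrK.
  rewrite !box_eq0 // => H; apply: nab => i; have := H i.
  by rewrite !mxE lerD2r.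
- by move=> k; exact: lebesgue_box_fin.
Qed.

Lemma lebesgue_ball_fin c (e : R) : (lam [set x : V | (`|x - c| < e)%R] <
  +oo)%E.
Proof.
apply: le_lt_trans (lebesgue_box_fin (c - const_mx e) (c + const_mx e)).
apply: le_measure; rewrite ?inE.
- apply: (@borel_open V); exact: (open_nball colnorm_group_norm).
- by apply: (@borel_closed V); exact: closed_box.
- move=> x /= xc i; have := le_lt_trans (entry_le_colnorm (x - c) i) xc.
  by rewrite !mxE ltr_norml; lra.
Qed.

Lemma lebesgue_ball_gt0 c (e : R) : 0 < e ->
  (0 < lam [set x : V | (`|x - c| < e)%R])%E.
Proof.
move=> e0; have e2 : 0 < e / 2 by rewrite divr_gt0.
have : (0 < lam (box (c - const_mx (e / 2))%R (c + const_mx (e / 2))%R))%E.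
  rewrite hlam; last by move=> i; rewrite !mxE; lra.
  by rewrite lte_fin prodr_gt0 // => i _; rewrite !mxE; lra.
move=> /lt_le_trans; apply; apply: le_measure; rewrite ?inE.
- by apply: (@borel_closed V); exact: closed_box.
- apply: (@borel_open V); exact: (open_nball colnorm_group_norm).
- move=> x xb; rewrite /= (@le_lt_trans _ _ (e / 2)) //; last by lra.
  apply/le_colnormP => [|i]; first exact: ltW.
  by have := xb i; rewrite !mxE ler_norml; lra.
Qed.

End lebesgue.

(** * Haar measure of balls in Z^n((B)) *)

Section haar.
Context {R : realType} {n : nat} {A : 'M[rat]_n.+1}.
Context {hA : expanding R A} {hb : (1 < Zindex A^-1)%N}.
Local Notation Zc := (Zcompl hA hb).

Lemma Zdist_group_norm : group_norm (fun y : Zc => Zdist y 0).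
Proof.
split.
- by rewrite Zdistxx.
- by move=> x; rewrite -sub0r Zdist_sub0 ZdistC.
- move=> x y; apply: le_trans (Zdist_tri y _ _) _.
  by rewrite -(Zdist_sub0 (x + y)) addrK.
move=> p U; split=> [/nbhs_ballP[e /= e0 eU]|[e e0 eU]].
  by exists e => // q; rewrite Zdist_sub0 ZdistC => pq; apply: eU;
    rewrite ballEmdist.
apply/nbhs_ballP; exists e => // q; rewrite ballEmdist /= => pq; apply: eU.
by rewrite Zdist_sub0 ZdistC.
Qed.

Lemma borel_Zball (c : Zc) (e : R) :
  measurable ([set y : Zc | (Zdist (y - c) 0 < e)%R] : set (borel Zc)).
Proof. apply: (@borel_open Zc); exact: (open_nball Zdist_group_norm). Qed.

Lemma borel_Zint : measurable (@Zint R n A hA hb : set (borel Zc)).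
Proof.
apply: (@borel_closed Zc); rewrite ZintE -[X in closed X]setCK.
apply: open_closedC; rewrite openE => x /= /negP; rewrite -ltNge => x1.
apply/(nbhs_normP Zdist_group_norm); exists (Zdist x 0 - 1);
  first by rewrite subr_gt0.
move=> y; rewrite /nball /= Zdist_sub0 => yx; apply/negP; rewrite -ltNge.
by have := Zdist_tri y x 0; rewrite [Zdist x y]ZdistC; lra.
Qed.

Context (muB : {measure set (borel Zc) -> \bar R}).
Hypothesis hmuB : is_haar muB.

Lemma haar_translation (c : Zc) (E : set (borel Zc)) : measurable E ->
  muB [set x : Zc | E (x + c)] = muB E.
Proof.
have [+ _ _] := hmuB => /(_ (- c) E) muBc /muBc <-; congr (muB _).
apply/seteqP; split=> [x Ex|_ [x Ex <-]] /=; last by rewrite addrAC addNr add0r.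
by exists (x + c); rewrite // addrC addrK.
Qed.

Lemma haar_ball_fin : (muB [set y : Zc | (Zdist y 0 < 1)%R] < +oo)%E.
Proof.
have [_ _ mu1] := hmuB; apply: le_lt_trans (_ : 1 < +oo)%E; last exact: ltry.
rewrite -mu1; apply: le_measure; rewrite ?inE.
- by have := borel_Zball 0 1; under eq_set do rewrite subr0.
- exact: borel_Zint.
- by rewrite ZintE => y /= /ltW.
Qed.

(** Finitely many translates of the ball cover Z^n[[B]], which has mass 1, so the ball cannot be
    null. *)
Lemma haar_ball_gt0 (c : Zc) (e : R) : 0 < e ->
  (0 < muB [set y : Zc | (Zdist (y - c) 0 < e)%R])%E.
Proof.
move=> e0; have [_ _ mu1] := hmuB.
have [s sP] := @Zball_totally_bounded R n A hA hb 2 e e0.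
have shift (p : Zc) : muB [set y : Zc | (Zdist (y - p) 0 < e)%R] =
    muB [set y : Zc | (Zdist (y - c) 0 < e)%R].
  rewrite -(haar_translation (c - p) (borel_Zball c e)); congr (muB _).
  by apply/seteqP; split=> y /=; rewrite addrA addrAC addrK.
have : (muB (@Zint R n A hA hb) <=
    \sum_(p <- s) muB [set y : Zc | (Zdist (y - p) 0 < e)%R])%E.
  apply: (@le_measure_seq_sup _ (borel Zc) _ muB _
    (fun p : Zc => [set y : borel Zc | (Zdist ((y : Zc) - p) 0 < e)%R])).
  - by move=> p; exact: borel_Zball.
  - exact: borel_Zint.
  - rewrite ZintE => y /= y1; have [|p ps yp] := sP y.
      by rewrite (le_lt_trans y1) // ltr1n.
    by exists p; rewrite /= ?Zdist_sub0.
rewrite mu1; under eq_bigr do rewrite shift; move=> le1.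
rewrite lt_neqAle measure_ge0 andbT; apply/eqP => mu0.
by move: le1; rewrite -mu0 big1 // lee_fin ler10.
Qed.

End haar.

(** * The product measure on K_A *)

Section KA_measure.
Context {R : realType} {n : nat} {A : 'M[rat]_n.+1}.
Context {hA : expanding R A} {hb : (1 < Zindex A^-1)%N}.
Local Notation K := (KA hA hb).
Local Notation V := 'cV[R]_n.+1.
Local Notation Zc := (Zcompl hA hb).
Local Notation mulA := (@KAmulA R n A hA hb).
Local Notation ZBg := (Defs_ZB__canonical__Algebra_Zmodule hA hb).

Lemma colvec_rat_dense (x : V) (e : R) : 0 < e ->
  exists v : 'cV[rat]_n.+1, `|x - map_mx ratr v| < e.
Proof.
move=> e0; have e2 : 0 < e / 2 by rewrite divr_gt0.
have /choice[q qP] k : exists q : rat, x k 0 - e / 2 < ratr q < x k 0.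
  have [|q] := @rat_in_itvoo R (x k 0 - e / 2) (x k 0); first by lra.
  by rewrite in_itv /=; exists q.
exists (\col_k q k); rewrite (@le_lt_trans _ _ (e / 2)) //; last by lra.
apply/le_colnormP => [|k]; first exact: ltW.
by have := qP k; rewrite !mxE ler_norml; lra.
Qed.

(** Rational vectors and Z^n(B) are countable and dense, so an open set is a countable union of
    products of balls and lies in the product sigma-algebra. *)
Lemma KA_open_measurable (U : set K) : open U ->
  measurable (U : set (borel V * borel Zc)).
Proof.
move=> oU.
pose c (v : 'cV[rat]_n.+1 * 'cV[rat]_n.+1) : K :=
  (map_mx ratr v.1, ZBin hb (insubd (0 : ZBg) v.2)).
pose S (q : 'cV[rat]_n.+1 * 'cV[rat]_n.+1 * nat) : set (borel V * borel Zc) :=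
  [set x : V | `|x - (c q.1).1| < q.2.+1%:R^-1] `*`
  [set y : Zc | Zdist (y - (c q.1).2) 0 < q.2.+1%:R^-1].
have SE q : S q = nball (@KAnorm R n A hA hb) (c q.1) q.2.+1%:R^-1.
  by apply/seteqP; split=> p; rewrite /S /nball /KAnorm /= gt_max => /andP.
rewrite (_ : U = \bigcup_(q in [set q | S q `<=` U]) S q); last first.
  apply/seteqP; split=> [p Up|p [q qU]]; last exact: qU.
  have [e e0 eU] : exists2 e : R, 0 < e &
    nball (@KAnorm R n A hA hb) p e `<=` U.
    by apply/(nbhs_normP KAnorm_group_norm); exact: open_nbhs_nbhs.
  have e2 : 0 < e / 2 by rewrite divr_gt0.
  have [m _ /(_ m (leqnn m)) me] := near_infty_natSinv_lt (PosNum e2).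
  have m0 : 0 < m.+1%:R^-1 :> R by rewrite invr_gt0.
  have [v vP] := colvec_rat_dense p.1 m0; have [w wP] := ZBin_dense p.2 m0.
  have pc : KAnorm (p - c (v, ZBval w)) < m.+1%:R^-1.
    by rewrite /KAnorm gt_max /c /= vP Zdist_sub0 ZdistC valKd.
  exists (v, ZBval w, m); last by rewrite SE.
  rewrite /= SE => q qc; apply: eU; move: qc me; rewrite /nball /=.
  have := group_norm_tri KAnorm_group_norm (c (v, ZBval w)) q p.
  rewrite [KAnorm (c _ - p)](group_norm_distC KAnorm_group_norm) => tri qc me.
  apply: (le_lt_trans tri); rewrite [e]splitr.
  by apply: ltrD; [exact: lt_trans qc me|exact: lt_trans pc me].
rewrite bigcup_mkcond; apply: countable_bigcupT_measurable => // q.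
case: ifP => _ //; apply: measurableX; last exact: borel_Zball.
apply: (@borel_open V); exact: (open_nball colnorm_group_norm).
Qed.

Context (lam : {measure set (borel V) -> \bar R}) (hlam : is_lebesgue lam).
Context (muB : {sigma_finite_measure set (borel Zc) ->
  \bar R}) (hmuB : is_haar muB).
Local Notation mu := (lam \x muB)%E.

Let mulA1 (x : V) : V := map_mx ratr A *m x.

Let iter_mulA k (p : K) : iter k mulA p = (iter k mulA1 p.1,
  iter k (@ZmulA R n A hA hb) p.2).
Proof. by elim: k => [|k IH] /=; [case: p|rewrite IH]. Qed.

Let mball1 k (c : V) (e : R) : measurable ([set x : V | `|iter k mulA1 (x - c)|
  < e] : set (borel V)).
Proof.
have sub x y : mulA1 (x - y) = mulA1 x - mulA1 y by exact: mulmxBr.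
have subk x y : iter k mulA1 (x - y) = iter k mulA1 x - iter k mulA1 y.
  by elim: k => //= k ->.
apply: (@borel_open V); under eq_set do rewrite subk.
apply: (open_iter_nball colnorm_group_norm) => //.
have [d d0 dP] := matrix_entries_bounded (map_mx ratr A : 'M[R]_n.+1).
by exists (n.+1%:R * d) => x; exact: colnorm_mulmx_le.
Qed.

Let mball2 k (c : Zc) (e : R) :
  measurable ([set y : Zc | Zdist (iter k (@ZmulA R n A hA hb) (y - c)) 0 < e]
    : set (borel Zc)).
Proof.
have subk x y : iter k (@ZmulA R n A hA hb) (x - y) =
    iter k (@ZmulA R n A hA hb) x - iter k (@ZmulA R n A hA hb) y.
  by elim: k => //= k ->; exact: ZmulAB.
apply: (@borel_open Zc); under eq_set do rewrite subk.
apply: (open_iter_nball Zdist_group_norm); first exact: ZmulAB.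
exists (Zindex A^-1)%:R => x;
  rewrite -[X in Zdist _ X](_ : @ZmulA R n A hA hb 0 = 0).
  by rewrite Zdist_ZmulA.
by have := ZmulAB (0 : Zc) 0; rewrite !subrr.
Qed.

Let mu_ball k (c : K) (e : R) : mu [set q : K | KAnorm (iter k mulA (q - c)) <
  e] =
  (lam [set x : V | (`|iter k mulA1 (x - c.1)| < e)%R] *
   muB [set y : Zc | (Zdist (iter k (@ZmulA R n A hA hb) (y - c.2)) 0 <
     e)%R])%E.
Proof.
rewrite -product_measure1E; [|exact: mball1|exact: mball2].
congr (mu _); apply/seteqP; split=> q; rewrite /= iter_mulA /KAnorm gt_max /=.
  by move/andP.
by move=> [-> ->].
Qed.

(** For the max norm these sets are products, so invariance of the two factors suffices. This is the
    invariance [mshift] required by [porous_null]. *)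
Lemma KA_mu_translation k (e : R) (c : K) :
  mu [set q : K | KAnorm (iter k mulA (q - c)) < e] =
  mu [set q : K | KAnorm (iter k mulA q) < e].
Proof.
transitivity (mu [set q : K | KAnorm (iter k mulA (q - 0)) < e]); last first.
  by under eq_set do rewrite subr0.
rewrite !mu_ball; congr (_ * _)%E.
  rewrite -(lebesgue_translation hlam (- c.1) (mball1 k 0 e)); congr (lam _).
  by apply/funext => x /=; rewrite subr0.
rewrite -(haar_translation hmuB (- c.2) (mball2 k 0 e)); congr (muB _).
by apply/funext => x /=; rewrite subr0.
Qed.

Lemma KA_mu_ball_fin : (mu (nball (@KAnorm R n A hA hb) 0%R 1) < +oo)%E.
Proof.
rewrite (mu_ball 0 0 1) lte_mul_pinfty //.
- rewrite ge0_fin_numE //; exact: lebesgue_ball_fin.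
- by rewrite /=; under eq_set do rewrite subr0; exact: haar_ball_fin.
Qed.

Lemma KA_mu_ball_gt0 (c : K) (e : R) : 0 < e ->
  (0 < mu (nball (@KAnorm R n A hA hb) c e))%E.
Proof.
move=> e0; rewrite (mu_ball 0 c e) mule_gt0 //.
  exact: lebesgue_ball_gt0.
exact: haar_ball_gt0.
Qed.

End KA_measure.

(** * The image of Z^n[A] in K_A *)

Section lattice.
Context {R : realType} {n : nat} {A : 'M[rat]_n.+1}.
Context {hA : expanding R A} {hb : (1 < Zindex A^-1)%N}.
Local Notation K := (KA hA hb).
Local Notation b := ((Zindex A^-1)%:R : R).
Local Notation ZBg := (Defs_ZB__canonical__Algebra_Zmodule hA hb).

Let uA : A \is a GRing.unit. Proof. exact: expanding_unit hA. Qed.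

Definition KAlattice : set K :=
  [set phi hb x | x in [set x : ZB hA | Zpoly A (ZBval x)]].

Lemma KAlattice_sub (k l : K) : KAlattice k -> KAlattice l -> KAlattice (k - l).
Proof.
move=> [x Ax <-] [y Ay <-]; exists ((x : ZBg) - (y : ZBg));
  first exact: Zpoly_sub.
by rewrite /phi ZBinB /= map_mxB.
Qed.

Lemma KAlattice_mulA (l : K) : KAlattice l -> KAlattice (KAmulA l).
Proof.
move=> [x Ax <-]; exists (ZBmulA x); first exact: Zpoly_mul.
by rewrite /phi /KAmulA /= map_mxM ZmulA_ZBin.
Qed.

(** A norm bound controls the entries through the real factor and, by [dnu_leP], places the point in
    B^-m Z^n[B] through the other one; [finite_Zpoly_cap] then applies. *)
Lemma KAlattice_locally_finite (r : R) :
  finite_set (KAlattice `&` [set l | KAnorm l < r]).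
Proof.
pose N : rat := (Num.truncn r).+1%:R.
have [m mr] : exists m : nat, r <= b ^ (- - m%:Z).
  have [|m] := @expVn_small R n A hb (Num.max r 1)^-1.
    by rewrite invr_gt0 lt_max ltr01 orbT.
  rewrite ltf_pV2 ?posrE ?exprn_gt0 ?lt_max ?ltr01 ?orbT ?ltr0n ?(ltnW hb) //.
  by rewrite gt_max => /andP[/ltW rm _]; exists m; rewrite opprK.
pose S := [set x : 'cV[rat]_n.+1 | [/\ Zpoly A x, Zfilt A^-1 (- m%:Z) x &
    forall i, `|x i 0| <= N]].
apply: (@sub_finite_set _ _ ((fun x => phi hb (insubd (0 : ZBg) x)) @` S));
  last first.
  exact/finite_image/finite_Zpoly_cap.
move=> _ [[x Ax <-]] /=; rewrite /KAnorm gt_max /= => /andP[x1 x2].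
exists (ZBval x); last by rewrite valKd.
split=> // [|i].
  apply/(dnu_leP (R := R)) => //; first by rewrite unitrV.
    exact: ZBvalP.
  by rewrite -Zdist_ZBin0 (le_trans (ltW x2)).
rewrite -(ler_rat R) ratr_norm ratr_nat.
have := entry_le_colnorm (map_mx ratr (ZBval x) : 'cV[R]_n.+1) i; rewrite mxE.
move=> /le_lt_trans/(_ x1) xr;
  have r0 : 0 <= r by rewrite (le_trans _ (ltW xr)).
have /andP[_ rN] := truncn_itv r0; exact: ltW (lt_trans xr rN).
Qed.

End lattice.

Theorem theorem3p4 (R : realType) (n : nat) (A : 'M[rat]_n.+1)
    (hA : expanding R A) (hb : (2 <= Zindex A^-1)%N)
    (D : {fset ZB hA}) (hD : digit_set D)
    (lam : {sigma_finite_measure set (borel 'cV[R]_n.+1) -> \bar R})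
    (hlam : is_lebesgue lam)
    (muB : {sigma_finite_measure set (borel (Zcompl hA hb)) -> \bar R})
    (hmuB : is_haar muB)
    (F : set (KA hA hb)) (hF : is_tile D F) :
  let mu := (lam \x muB)%E in
  ((0 < mu F)%E <-> interior F !=set0) /\
  (interior F !=set0 <->
     F = closure (interior F) /\ mu (boundary F) = 0%E).
Proof.
move=> mu; have [F0 cF tileF] := hF.
have clF : closed F := compact_closed KA_hausdorff cF.
have [B [AK BK]] := @KAmulA_bij R n A hA hb.
have DL d : [set` D] d -> KAlattice (phi hb d) by move=> dD; exists d => //;
  apply hD.1.
(* Used twice: for [F] itself when its interior is empty, and for the boundary of [F]. *)
have nullX (X : set (KA hA hb)) : compact X -> closed X -> interior X = set0 ->
    (forall x, X x -> exists2 d, [set` D] d & X (KAmulA x - phi hb d)) ->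
      mu X = 0%E.
  move=> cX clX iX AX.
  apply: (@porous_null R (KA hA hb) (@KAnorm R n A hA hb) KAnorm_group_norm
    (@KAmulA R n A hA hb) B KAmulAB BK KAmulA_lipschitz _
    (borel 'cV[R]_n.+1 * borel (Zcompl hA hb))%type (lam \x muB)%E (fun x => x)
    _ _ _ _ _ X KAlattice) => //.
  - exact: KA_open_measurable.
  - by move=> k e p; exact: KA_mu_translation.
  - exact: KAmulA_expanding.
  - exact: KA_totally_bounded.
  - by exists 1 => //; exact: KA_mu_ball_fin.
  - exact: KAlattice_sub.
  - exact: KAlattice_locally_finite.
  - exact: KAlattice_mulA.
  - by move=> x /AX[d /DL dL Xd]; exists (phi hb d).
have pos : interior F !=set0 -> (0 < mu F)%E.
  move=> [p /(nbhs_normP KAnorm_group_norm)[e e0 eF]].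
  apply: (lt_le_trans (KA_mu_ball_gt0 hlam hmuB p e0)).
  apply: (@le_measure _ _ _ (lam \x muB)%E); rewrite ?inE //.
    by apply: KA_open_measurable; exact: (open_nball KAnorm_group_norm).
  rewrite -[F]setCK; apply: measurableC.
  by apply: KA_open_measurable; exact: closed_openC.
split; split=> //.
- move=> Fpos; apply/set0P/negP => /eqP iF.
  by move: Fpos; rewrite nullX ?ltxx //; exact: (tile_out tileF).
- move=> iF; split.
    exact: (tile_closure_interior KAnorm_group_norm KAmulAB AK BK
      KAmulA_lipschitz KAmulA_expanding cF clF tileF iF).
  apply: nullX; [exact: compact_boundary|exact: closed_boundary|exact:
    interior_boundary|].
  exact: (boundary_tile_out KAnorm_group_norm KAmulAB AK KAmulA_lipschitz clF
    tileF).
(* With empty interior, [FE] would make [F] the closure of the empty set, contradicting that a tile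
   is nonempty. *)
- move=> [FE _]; apply/set0P/negP => /eqP iF; move: F0; rewrite FE iF closure0.
  by case.
Qed.
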